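(* Let $\mathcal{H}$ be an infinite dimensional complex Hilbert space and suppose that $T\in\mathcal{B}(\mathcal{H})$ is reduced by each of its eigenspaces. Then for every $f\in H(\sigma(T))$ the generalized Browder's theorem holds for $f(T)$, i.e. $\sigma(f(T))\setminus\sigma_{BW}(f(T))=p_0(f(T))$. In particular, the generalized Browder's theorem holds for $T$, i.e. $\sigma(T)\setminus\sigma_{BW}(T)=p_0(T)$.
   Context: $\mathcal{B}(\mathcal{H})$ is the algebra of bounded linear operators on $\mathcal{H}$. $T$ is reduced by each of its eigenspaces if for every eigenvalue $\lambda$ of $T$ the subspace $N(T-\lambda)$ reduces $T$ (is invariant under $T$ and $T^*$). $H(\sigma(T))$ is the space of functions analytic on an open neighborhood of the spectrum $\sigma(T)$, and $f(T)$ is defined by the holomorphic functional calculus. $p_0(T)$ is the set of poles (of the resolvent) of $T$. $N(T)$, $R(T)$ denote null space and range; $T$ is Fredholm if $\dim N(T)<\infty$ and $R(T)$ is closed of finite codimension, with index $i(T)=\dim N(T)-\operatorname{codim}R(T)$. For a nonnegative integer $n$, $T_{[n]}$ is the restriction of $T$ to $R(T^n)$, viewed as a map from $R(T^n)$ into $R(T^n)$ ($T_{[0]}=T$). $T$ is $B$-Fredholm if for some $n$ the range $R(T^n)$ is closed and $T_{[n]}$ is Fredholm. The degree of stable iteration of $T$ is $d=\operatorname{dis}T:=\inf\{n\in\mathbb{Z}_+: m\in\mathbb{Z}_+, m\ge n\Rightarrow R(T^n)\cap N(T)\subseteq R(T^m)\cap N(T)\}$; for $B$-Fredholm $T$ the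 index is $i(T):=i(T_{[d]})$ (and $i(T_{[m]})=i(T_{[d]})$ for all $m\ge d$). $T$ is $B$-Weyl if it is $B$-Fredholm of index $0$. $\sigma_{BW}(T)=\{\lambda\in\mathbb{C}: T-\lambda\text{ is not }B\text{-Weyl}\}$. *)

(* Defs.v *)
(* Stdlib real numbers with Coquelicot (normed modules, complex numbers,
   Riemann integral). *)
From Stdlib Require Export Reals ZArith List Permutation.
From Coquelicot Require Export Coquelicot.
Open Scope R_scope.

(* The inner product is linear in the first argument; the last field says that
   the norm of the complete normed space is the one it induces, which also
   gives positivity and definiteness. *)
Record HilbertSpace := {
  hs_space :> CompleteNormedModule C_AbsRing;
  inner : hs_space -> hs_space -> C;
  inner_plus : forall x y z, inner (plus x y) z = (inner x z + inner y z)%C;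
  inner_scal : forall (a : C) x y, inner (scal a x) y = (a * inner x y)%C;
  inner_conj : forall x y, inner y x = Cconj (inner x y);
  inner_norm : forall x, inner x x = RtoC (norm x ^ 2)
}.
Arguments inner {h} _ _.

Section Operators.
Context {H : HilbertSpace}.
Implicit Types (T S A : H -> H) (M L : H -> Prop).

(* Throughout, "T is a bounded linear operator" is Coquelicot's [is_linear T],
   and a subspace is given by its membership predicate. *)

Definition shift T (l : C) : H -> H := fun x => minus (T x) (scal l x).
Definition power T (n : nat) : H -> H := fun x => Nat.iter n T x.
Definition null T : H -> Prop := fun x => T x = zero.
Definition range T : H -> Prop := fun y => exists x, T x = y.

(* [iota] is definite description: for bounded linear T, the vector z below
   exists and is unique by the Riesz representation theorem. *)
Definition adjoint T : H -> H :=
  fun y => iota (fun z : H => forall x, inner (T x) y = inner x z).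

Definition reduces M T : Prop :=
  (forall x, M x -> M (T x)) /\ (forall x, M x -> M (adjoint T x)).

Definition eigenvalue T (l : C) : Prop := exists x, x <> zero /\ T x = scal l x.

Definition reduced_by_eigenspaces T : Prop :=
  forall l : C, eigenvalue T l -> reduces (null (shift T l)) T.

(* dim (M / L) = n, for subspaces L of M: the classes of e 1, ..., e n form a
   basis of M / L.  The sum is empty for n = 0. *)
Definition lincomb (a : nat -> C) (e : nat -> H) (n : nat) : H :=
  sum_n_m (fun i => scal (a i) (e i)) 1 n.

Definition quotient_dim M L (n : nat) : Prop :=
  exists e : nat -> H,
    (forall i, (1 <= i <= n)%nat -> M (e i)) /\
    (forall a : nat -> C, L (lincomb a e n) ->
       forall i, (1 <= i <= n)%nat -> a i = RtoC 0) /\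
    (forall x, M x -> exists a : nat -> C, L (minus x (lincomb a e n))).

Definition dim M (n : nat) : Prop := quotient_dim M (fun x => x = zero) n.

Definition infinite_dimensional : Prop := ~ exists n, dim (fun _ => True) n.

(* The operator induced by T on a T-invariant subspace M. *)
Definition null_on M T : H -> Prop := fun x => M x /\ T x = zero.
Definition range_on M T : H -> Prop := fun y => exists x, M x /\ T x = y.

(* Used below only for closed M, where being closed in M is being closed
   in H. *)
Definition Fredholm_on M T : Prop :=
  (exists a, dim (null_on M T) a) /\
  closed (range_on M T) /\
  (exists b, quotient_dim M (range_on M T) b).

Definition index_on M T (k : Z) : Prop :=
  exists a b : nat,
    dim (null_on M T) a /\ quotient_dim M (range_on M T) b /\
    k = (Z.of_nat a - Z.of_nat b)%Z.

Definition BFredholm T : Prop :=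
  exists n, closed (range (power T n)) /\ Fredholm_on (range (power T n)) T.

Definition stable_from T (n : nat) : Prop :=
  forall m x, (n <= m)%nat ->
    range (power T n) x /\ null T x -> range (power T m) x /\ null T x.

(* d is the degree of stable iteration of T (which is thus finite). *)
Definition is_dis T (d : nat) : Prop :=
  stable_from T d /\ forall n, stable_from T n -> (d <= n)%nat.

Definition B_index T (k : Z) : Prop :=
  exists d, is_dis T d /\ index_on (range (power T d)) T k.

Definition BWeyl T : Prop := BFredholm T /\ B_index T 0%Z.

Definition invertible A : Prop :=
  exists B : H -> H, is_linear B /\ forall x, B (A x) = x /\ A (B x) = x.

Definition spectrum T (l : C) : Prop := ~ invertible (shift T l).
Definition spectrum_BW T (l : C) : Prop := ~ BWeyl (shift T l).

(* (z - T)^{-1}; only meaningful for z outside the spectrum. *)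
Definition resolvent T (z : C) : H -> H :=
  fun y => iota (fun x : H => minus (scal z x) (T x) = y).

(* The series of operators F 0 + F 1 + ... converges to A in operator norm. *)
Definition op_series (F : nat -> H -> H) A : Prop :=
  forall eps : posreal, exists N : nat, forall n, (N <= n)%nat -> forall x,
    norm (minus (sum_n (fun j => F j x) n) (A x)) <= eps * norm x.

(* l is an isolated point of the spectrum, around which the resolvent has a
   Laurent expansion (z - T)^{-1} = sum_j (z - l)^(j - k) Q_j with k >= 1 and
   Q_0 <> 0, i.e. l is a pole of order k. *)
Definition pole T (l : C) : Prop :=
  spectrum T l /\
  exists (k : nat) (r : posreal) (Q : nat -> H -> H),
    (1 <= k)%nat /\
    (forall j, is_linear (Q j)) /\
    (exists x, Q 0%nat x <> zero) /\
    forall z : C, 0 < Cmod (z - l)%C < r ->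
      ~ spectrum T z /\
      op_series (fun j x => scal ((z - l) ^ j)%C (Q j x))
                (fun x => scal ((z - l) ^ k)%C (resolvent T z x)).

Definition generalized_Browder T : Prop :=
  forall l : C, (spectrum T l /\ ~ spectrum_BW T l) <-> pole T l.

End Operators.
Arguments infinite_dimensional H : clear implicits.

(* C^1 arc parametrized by [0, 1], extended to a neighborhood of it. *)
Record arc := {
  arc_pos :> R -> C;
  arc_vel : R -> C;
  arc_derive : forall t, 0 <= t <= 1 ->
    is_derive (V := C_R_NormedModule) arc_pos t (arc_vel t);
  arc_cont : forall t, 0 <= t <= 1 ->
    continuous (U := C_UniformSpace) arc_vel t
}.

Definition contour := list arc.

(* Initial points and end points agree with multiplicity: the arcs can be
   joined into finitely many closed piecewise C^1 paths. *)
Definition is_cycle (G : contour) : Prop :=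
  Permutation (map (fun g : arc => g 0) G) (map (fun g : arc => g 1) G).

Definition on_contour (G : contour) (z : C) : Prop :=
  exists g : arc, In g G /\ exists t, 0 <= t <= 1 /\ g t = z.

Definition contour_int (G : contour) (h : C -> C) : C :=
  fold_right Cplus (RtoC 0)
    (map (fun g : arc =>
       RInt (V := C_R_CompleteNormedModule)
         (fun t => (h (g t) * arc_vel g t)%C) 0 1) G).

Definition winding (G : contour) (z : C) : C :=
  (/ (2 * PI * Ci) * contour_int G (fun w => / (w - z)))%C.

(* G surrounds K in U: it lies in U \ K and has winding number 1 around the
   points of K and 0 around the points outside U. *)
Definition surrounds (G : contour) (K U : C -> Prop) : Prop :=
  is_cycle G /\
  (forall z, on_contour G z -> U z /\ ~ K z) /\
  (forall z, K z -> winding G z = RtoC 1) /\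
  (forall z, ~ U z -> winding G z = RtoC 0).

Definition holomorphic_on (U : C -> Prop) (f : C -> C) : Prop :=
  forall z, U z -> ex_derive (K := C_AbsRing) (V := C_NormedModule) f z.

(* f, defined on U, belongs to H(K). *)
Definition analytic_near (K U : C -> Prop) (f : C -> C) : Prop :=
  open (T := C_UniformSpace) U /\ (forall z, K z -> U z) /\ holomorphic_on U f.

(* S = f(T), i.e. S = 1/(2 pi i) int_G f(z) (z - T)^{-1} dz for a contour G
   surrounding the spectrum of T in U.  The integrand is continuous in operator
   norm, so the integral is determined by its matrix entries <S x, y>. *)
Definition is_functional_calculus {H : HilbertSpace} (T : H -> H)
    (U : C -> Prop) (f : C -> C) (S : H -> H) : Prop :=
  is_linear S /\
  exists G : contour,
    surrounds G (spectrum T) U /\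
    forall x y : H,
      inner (S x) y =
      (/ (2 * PI * Ci) *
         contour_int G (fun z => f z * inner (resolvent T z x) y))%C.

(* Main.v *)
(* Write N = S - l, where S is f(T) or T itself. If N is B-Weyl with degree of
   stable iteration d, then ker N meets R(N^d) in a finite-dimensional subspace E
   which is contained in R(N), invariant under T, and of dimension the codimension of
   R(N^(d+1)) in R(N^d). If E were nonzero, it would contain an eigenvector x of T,
   T x = mu x. Since the eigenspace M of mu reduces T, the operator S acts as the
   scalar l on M and leaves its orthogonal complement invariant, so N vanishes on M
   and x is not in R(N), a contradiction. Hence H is the direct sum of ker N^d and
   R(N^d), with N bijective on the latter; the bounded inverse theorem makes the
   spectral projection P and the Drazin inverse D of N bounded, and
   (w - N)^-1 = sum_(i < d) w^(-i-1) N^i P - sum_j w^j D^(j+1).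
   Conversely, the recurrence satisfied by the Laurent coefficients of the resolvent
   at a pole of order k gives the same decomposition with d = k. *)
Require Import Defs.
From Stdlib Require Import Lra Lia Classical ClassicalEpsilon.
From Corelib Require Import ssreflect.
From mathcomp Require all_boot all_algebra complex Rstruct.

(** * Inner product and norm *)

(** The hypothesis concerns the eigenspaces of T, while N is built from S. This is why E has to
    yield an eigenvector of T, and hence why E must be both finite-dimensional and T-invariant.
    Index 0 makes E = 0 count twice: N is then injective and also surjective on R(N^d). For S =
    f(T), three facts suffice: S commutes with T, S is scalar on an eigenspace of T that contains a
    nonzero x with S x = l x, and S preserves the orthogonal complement of that eigenspace. The
    calculus determines S through the entries <S x, y>, so each fact is obtained by comparing
    integrands at the points of the contour, where the resolvent exists because the contour avoids
    the spectrum. A pole requires bounded coefficients and convergence in operator norm, so the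
    algebraic splitting of H is not enough. Boundedness of P and D is drawn from the bounded inverse
    theorem, itself derived from uniform boundedness and the adjoint. *)

Ltac C_ext := apply injective_projections; rewrite /=; ring.

Section InnerProduct.
Context {H : HilbertSpace}.
Implicit Types (x y z : H) (a b : C).

Lemma inner_zero_l y : inner (zero : H) y = RtoC 0.
Proof.
have -> : (zero : H) = scal (RtoC 0 : C_AbsRing) (zero : H) by rewrite scal_zero_r.
by rewrite inner_scal Cmult_0_l.
Qed.

Lemma inner_opp_l x y : inner (opp x) y = Copp (inner x y).
Proof.
have -> : opp x = scal (opp one : C_AbsRing) x by rewrite scal_opp_one.
rewrite inner_scal /opp /one /=. ring.
Qed.

Lemma inner_minus_l x y z : inner (minus x y) z = Cminus (inner x z) (inner y z).
Proof. by rewrite /minus inner_plus inner_opp_l. Qed.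

Lemma inner_plus_r x y z : inner x (plus y z) = Cplus (inner x y) (inner x z).
Proof. rewrite inner_conj inner_plus (inner_conj _ y x) (inner_conj _ z x). C_ext. Qed.

Lemma inner_scal_r a x y : inner x (scal a y) = Cmult (Cconj a) (inner x y).
Proof. rewrite inner_conj inner_scal (inner_conj _ y x). C_ext. Qed.

Lemma inner_zero_r x : inner x (zero : H) = RtoC 0.
Proof. rewrite inner_conj inner_zero_l. C_ext. Qed.

Lemma inner_opp_r x y : inner x (opp y) = Copp (inner x y).
Proof. rewrite inner_conj inner_opp_l (inner_conj _ y x). C_ext. Qed.

Lemma inner_minus_r x y z : inner x (minus y z) = Cminus (inner x y) (inner x z).
Proof. by rewrite /minus inner_plus_r inner_opp_r. Qed.

Lemma inner_self_zero x : inner x x = RtoC 0 -> x = zero.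
Proof.
rewrite inner_norm => h. apply: norm_eq_zero. move/RtoC_inj: h => h. nra.
Qed.

Lemma inner_sym_zero x y : inner x y = RtoC 0 -> inner y x = RtoC 0.
Proof. move=> h. rewrite inner_conj h. C_ext. Qed.

Lemma minus_zero x y : minus x y = zero -> x = y.
Proof.
move=> h. by rewrite -(plus_zero_l y) -h /minus -plus_assoc plus_opp_l plus_zero_r.
Qed.

Lemma inner_ext x y : (forall z, inner x z = inner y z) -> x = y.
Proof.
move=> h. apply: minus_zero. apply: inner_self_zero. rewrite inner_minus_l h. ring.
Qed.

End InnerProduct.

(* An identity between vectors follows from the scalar identity of their inner
   products with an arbitrary vector, which [ring] or [field] can prove. *)
Ltac vec := apply: inner_ext; let z := fresh "z" in intro z;
  rewrite ?(inner_plus, inner_minus_l, inner_scal, inner_opp_l, inner_zero_l);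
  change (@opp C_AbsRing) with Copp;
  change (@one C_AbsRing) with (RtoC 1);
  change (@zero C_AbsRing) with (RtoC 0).

Section Norm.
Context {H : HilbertSpace}.
Implicit Types (x y z : H) (a b : C).

Lemma norm_sqr x : norm x ^ 2 = fst (inner x x).
Proof. by rewrite inner_norm. Qed.

Lemma Cmod_sqr a : Cmod a ^ 2 = fst a ^ 2 + snd a ^ 2.
Proof. rewrite /Cmod pow2_sqrt //. nra. Qed.

Lemma norm_scal_eq a x : norm (scal a x) = Cmod a * norm x.
Proof.
have h : norm (scal a x) ^ 2 = (Cmod a * norm x) ^ 2.
  rewrite norm_sqr Rpow_mult_distr Cmod_sqr inner_scal inner_scal_r inner_norm /=. ring.
apply: Rsqr_inj; first exact: norm_ge_0.
- apply: Rmult_le_pos; [exact: Cmod_ge_0 | exact: norm_ge_0].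
- by rewrite !Rsqr_pow2.
Qed.

Lemma norm_minus_sym x y : norm (minus x y) = norm (minus y x).
Proof. by rewrite -norm_opp opp_minus. Qed.

Lemma norm_sqr_plus x y :
  norm (plus x y) ^ 2 = norm x ^ 2 + norm y ^ 2 + 2 * fst (inner x y).
Proof.
rewrite !norm_sqr inner_plus !inner_plus_r (inner_conj _ x y) /=. ring.
Qed.

Lemma norm_sqr_minus x y :
  norm (minus x y) ^ 2 = norm x ^ 2 + norm y ^ 2 - 2 * fst (inner x y).
Proof. rewrite norm_sqr_plus norm_opp inner_opp_r /=. ring. Qed.

Lemma parallelogram x y :
  norm (plus x y) ^ 2 + norm (minus x y) ^ 2 = 2 * norm x ^ 2 + 2 * norm y ^ 2.
Proof. rewrite norm_sqr_plus norm_sqr_minus. ring. Qed.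

Lemma cauchy_schwarz x y : Cmod (inner x y) <= norm x * norm y.
Proof.
have nx := norm_ge_0 x. have ny := norm_ge_0 y.
have mp := Cmod_ge_0 (inner x y).
case: (Req_dec (norm y) 0) => [y0|y0].
  have -> : y = zero by exact: norm_eq_zero.
  rewrite inner_zero_r Cmod_0. by apply: Rmult_le_pos; exact: norm_ge_0.
(* This vector is |y|^2 times the component of x orthogonal to y; its squared norm is |y|^2 (|x|^2
   |y|^2 - |<x, y>|^2). *)
have := norm_sqr_minus (scal (RtoC (norm y ^ 2)) x) (scal (inner x y) y).
rewrite !norm_scal_eq inner_scal inner_scal_r Cmod_R (Rabs_pos_eq (norm y ^ 2)); last by nra.
set p := inner x y.
have -> : fst (RtoC (norm y ^ 2) * (Cconj p * p))%C = norm y ^ 2 * Cmod p ^ 2.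
  rewrite Cmod_sqr /=. ring.
have := pow2_ge_0 (norm (minus (scal (RtoC (norm y ^ 2)) x) (scal p y))).
fold p in mp. move=> h1 h2. rewrite h2 in h1.
have h3 : 0 <= norm y ^ 2 * ((norm x * norm y) ^ 2 - Cmod p ^ 2) by nra.
have h4 : 0 < norm y ^ 2 by exact: pow2_gt_0.
have h5 : 0 <= (norm x * norm y) ^ 2 - Cmod p ^ 2 by apply: (Rmult_le_reg_l (norm y ^ 2)) => //;
  rewrite Rmult_0_r.
have h6 : 0 <= norm x * norm y by nra.
apply: Rsqr_incr_0 => //; rewrite !Rsqr_pow2; lra.
Qed.

Lemma norm_minus_triangle x y z : norm (minus x z) <= norm (minus x y) + norm (minus y z).
Proof.
have -> : minus x z = plus (minus x y) (minus y z) by vec; ring.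
exact: norm_triangle.
Qed.

(** Phrased with the norm because the balls of the uniform structure agree with norm balls only up
    to [norm_factor]. *)
Definition conv (u : nat -> H) (l : H) : Prop :=
  forall eps, 0 < eps -> exists N, forall n, (N <= n)%nat -> norm (minus (u n) l) < eps.

Lemma cauchy_conv (u : nat -> H) :
  (forall eps, 0 < eps -> exists N, forall n m, (N <= n)%nat -> (N <= m)%nat ->
     norm (minus (u n) (u m)) < eps) ->
  exists l, conv u l.
Proof.
move=> h.
case: (proj1 (filterlim_locally_cauchy (U := hs_space H) (F := eventually) u)).
  move=> eps. case: (h eps (cond_pos eps)) => N hN.
  exists (fun n => (N <= n)%nat); split; first by exists N.
  move=> n m hn hm. apply: norm_compat1. exact: hN.
move=> l hl. exists l => eps e0.
have f0 : 0 < eps / @norm_factor _ (hs_space H).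
  apply: Rdiv_lt_0_compat => //. exact: norm_factor_gt_0.
move/filterlim_locally: hl => /(_ (mkposreal _ f0)) [N hN].
exists N => n hn.
have := norm_compat2 _ _ _ (hN n hn). rewrite /=.
have fp := @norm_factor_gt_0 _ (hs_space H).
have -> : @norm_factor _ (hs_space H) * (eps / @norm_factor _ (hs_space H)) = eps by field; lra.
by [].
Qed.

Lemma pow_to_zero c M eps : 0 <= c < 1 -> 0 < eps ->
  exists N, forall n, (N <= n)%nat -> M * c ^ n < eps.
Proof.
move=> [c0 c1] e0.
have M1 : 0 < Rabs M + 1 by have := Rabs_pos M; lra.
case: (pow_lt_1_zero c _ (eps / (Rabs M + 1))).
- rewrite Rabs_pos_eq; lra.
- exact: Rdiv_lt_0_compat.
move=> N hN. exists N => n hn. have := hN n hn.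
have cn := pow_le c n c0.
rewrite Rabs_pos_eq // => h.
have : (Rabs M + 1) * c ^ n < eps.
  apply: (Rlt_le_trans _ ((Rabs M + 1) * (eps / (Rabs M + 1)))); first by apply: Rmult_lt_compat_l.
  right; field; lra.
have := Rle_abs M. nra.
Qed.

Lemma geometric_dist (u : nat -> H) M c : 0 <= c < 1 -> 0 <= M ->
  (forall n, norm (minus (u (S n)) (u n)) <= M * c ^ n) ->
  forall n k, norm (minus (u (n + k)%nat) (u n)) <= M * c ^ n / (1 - c).
Proof.
move=> hc hM hu n k.
(* The factor 1 - c^k records the exact partial geometric sum, which the induction on k needs. *)
have : norm (minus (u (n + k)%nat) (u n)) <= M * c ^ n * (1 - c ^ k) / (1 - c).
  elim: k => [|k IH].
    rewrite Nat.add_0_r.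
    have -> : minus (u n) (u n) = zero by exact: minus_eq_zero.
    rewrite norm_zero /=. right; field; lra.
  apply: Rle_trans (norm_minus_triangle _ (u (n + k)%nat) _) _.
  have := hu (n + k)%nat. rewrite -plus_n_Sm => h.
  have -> : M * c ^ n * (1 - c ^ S k) / (1 - c) =
    M * c ^ (n + k) + M * c ^ n * (1 - c ^ k) / (1 - c).
    rewrite pow_add /=; field; lra.
  lra.
move=> h; apply: Rle_trans h _.
apply: Rmult_le_compat_r; first by apply: Rlt_le; apply: Rinv_0_lt_compat; lra.
have a1 := pow_le c n (proj1 hc). have a2 := pow_le c k (proj1 hc).
have : 0 <= M * c ^ n by nra. nra.
Qed.

Lemma conv_dist_le (u : nat -> H) l x B :
  conv u l -> (exists N, forall n, (N <= n)%nat -> norm (minus (u n) x) <= B) ->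
  norm (minus l x) <= B.
Proof.
move=> ul [N hB]. apply: le_epsilon => eps e0.
case: (ul eps e0) => N' hN'.
have h1 := hN' (N + N')%nat ltac:(lia). have h2 := hB (N + N')%nat ltac:(lia).
have := norm_minus_triangle l (u (N + N')%nat) x. rewrite (norm_minus_sym l (u _)). lra.
Qed.

Lemma geometric_conv (u : nat -> H) M c : 0 <= c < 1 -> 0 <= M ->
  (forall n, norm (minus (u (S n)) (u n)) <= M * c ^ n) ->
  exists l, conv u l /\ forall n, norm (minus l (u n)) <= M * c ^ n / (1 - c).
Proof.
move=> hc hM hu. have hd := geometric_dist u M c hc hM hu.
case: (cauchy_conv u).
  move=> eps e0.
  case: (pow_to_zero c (2 * M / (1 - c)) eps hc e0) => N hN.
  exists N => n m hn hm.
  have h1 := hd N (n - N)%nat. have h2 := hd N (m - N)%nat.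
  rewrite (_ : (N + (n - N))%nat = n) in h1; last lia.
  rewrite (_ : (N + (m - N))%nat = m) in h2; last lia.
  have := norm_minus_triangle (u n) (u N) (u m). rewrite (norm_minus_sym (u N)).
  have := hN N (le_n N).
  have -> : 2 * M / (1 - c) * c ^ N = M * c ^ N / (1 - c) + M * c ^ N / (1 - c) by field; lra.
  lra.
move=> l ul; exists l; split => // n.
apply: (conv_dist_le u) => //. exists n => m hm.
by have := hd n (m - n)%nat; rewrite (_ : (n + (m - n))%nat = m); last lia.
Qed.

Lemma conv_unique u l l' : conv u l -> conv u l' -> l = l'.
Proof.
move=> h h'. apply: minus_zero. apply: norm_eq_zero. apply: Rle_antisym; last exact: norm_ge_0.
apply: le_epsilon => eps e0. rewrite Rplus_0_l.
apply: (conv_dist_le u) => //. case: (h' eps e0) => N hN. exists N => n hn.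
by apply: Rlt_le; apply: hN.
Qed.

Lemma conv_linear (A : H -> H) u l : is_linear A -> conv u l -> conv (fun n => A (u n)) (A l).
Proof.
move=> hA ul eps e0. case: (linear_norm A hA) => K [K0 hK].
case: (ul (eps / K)); first exact: Rdiv_lt_0_compat.
move=> N hN; exists N => n hn. rewrite -linear_minus //.
apply: Rle_lt_trans (hK _) _.
apply: (Rlt_le_trans _ (K * (eps / K))); last by right; field; lra.
apply: Rmult_lt_compat_l => //. exact: hN.
Qed.

End Norm.

(** * Orthogonal projection and adjoint *)

Section Projection.
Context {H : HilbertSpace}.
Implicit Types (x y z : H) (a b : C) (M : H -> Prop).

Record closed_subspace M : Prop := {
  subspace_zero : M zero;
  subspace_plus : forall x y, M x -> M y -> M (plus x y);
  subspace_scal : forall a x, M x -> M (scal a x);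
  subspace_lim : forall u l, (forall n, M (u n)) -> conv u l -> M l
}.

Lemma subspace_minus M x y : closed_subspace M -> M x -> M y -> M (minus x y).
Proof.
move=> hM hx hy. have -> : minus x y = plus x (scal (Copp (RtoC 1)) y) by vec; ring.
by apply: subspace_plus => //; apply: subspace_scal.
Qed.

(** [completeness] yields suprema, so the infimum d is taken as the opposite of a supremum. The
    tolerance 4^-n on squared distances is the square of the rate 2^-n wanted for the points
    themselves. *)
Lemma near_minimizers M x : closed_subspace M -> exists d (m : nat -> H),
  (forall y, M y -> d <= norm (minus x y) ^ 2) /\
  forall n, M (m n) /\ norm (minus x (m n)) ^ 2 < d + (/ 4) ^ n.
Proof.
move=> hM.
set E := fun r => exists y, M y /\ r = - norm (minus x y) ^ 2.
case: (completeness E).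
- exists 0 => r [y [_ ->]]. have := pow2_ge_0 (norm (minus x y)). lra.
- exists (- norm (minus x zero) ^ 2), zero; split => //. exact: subspace_zero.
move=> s [hs1 hs2].
have h n : exists y, M y /\ norm (minus x y) ^ 2 < - s + (/ 4) ^ n.
  have p4 : 0 < (/ 4) ^ n by apply: pow_lt; lra.
  apply: NNPP => hn.
  have : s <= s - (/ 4) ^ n.
    apply: hs2 => r [y [hy ->]]. apply: Rnot_lt_le => hlt.
    apply: hn; exists y; split => //. lra.
  lra.
exists (- s), (fun n => proj1_sig (constructive_indefinite_description _ (h n))); split.
- move=> y hy. have := hs1 (- norm (minus x y) ^ 2).
  have : E (- norm (minus x y) ^ 2) by exists y.
  move=> h1 h2. have := h2 h1. lra.
- move=> n. exact: (proj2_sig (constructive_indefinite_description _ (h n))).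
Qed.

Lemma nearest_point M x : closed_subspace M ->
  exists p, M p /\ forall y, M y -> norm (minus x p) <= norm (minus x y).
Proof.
move=> hM. case: (near_minimizers M x hM) => d [m [hd hm]].
have step n : norm (minus (m (S n)) (m n)) <= 2 * (/ 2) ^ n.
  have [m1 d1] := hm n. have [m2 d2] := hm (S n).
  (* The midpoint of m_n and m_(n+1) lies in M, so its squared distance to x is at least d; the
     parallelogram law leaves |m_(n+1) - m_n|^2 < 4 * 4^-n. *)
  have := parallelogram (minus x (m n)) (minus x (m (S n))).
  have -> : minus (minus x (m n)) (minus x (m (S n))) = minus (m (S n)) (m n) by vec; ring.
  have -> : plus (minus x (m n)) (minus x (m (S n))) =
    scal (RtoC 2) (minus x (scal (RtoC (/2)) (plus (m n) (m (S n))))).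
    vec. rewrite RtoC_inv; last lra. field.
  rewrite norm_scal_eq Cmod_R (Rabs_pos_eq 2); last lra.
  have := hd (scal (RtoC (/2)) (plus (m n) (m (S n))))
    (subspace_scal _ hM _ _ (subspace_plus _ hM _ _ m1 m2)).
  set q := norm _. move=> h1 h2.
  have p4 : (/ 4) ^ n = ((/ 2) ^ n) ^ 2.
    rewrite -pow_mult Nat.mul_comm pow_mult. congr pow. field.
  have p2 : 0 < (/ 2) ^ n by apply: pow_lt; lra.
  rewrite /= in d2. rewrite -/pow in d2.
  have d2' : norm (minus x (m (S n))) ^ 2 < d + (/ 4) ^ n.
    have : 0 < (/ 4) ^ n by apply: pow_lt; lra.
    move: d2; rewrite /=; lra.
  apply: Rsqr_incr_0; [rewrite !Rsqr_pow2; nra | exact: norm_ge_0 | lra].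
case: (geometric_conv m 2 (/2)) => //; [lra | lra |] => p [mp hp].
exists p; split.
  apply: (subspace_lim _ hM m) => // n. exact: (proj1 (hm n)).
move=> y hy. apply: Rnot_lt_le => hlt.
(* If y beat p by g, a late m_n would be within g/2 of p and have distance to x below |x - y| + g/2,
   against the triangle inequality. *)
set g := norm (minus x p) - norm (minus x y).
have g0 : 0 < g by rewrite /g; lra.
case: (pow_to_zero (/2) 4 (g / 2)); [lra | lra |] => N1 hN1.
case: (pow_to_zero (/4) 1 (g ^ 2 / 4)); [lra | by nra |] => N2 hN2.
pose n := (N1 + N2)%nat.
have a1 := hN1 n ltac:(rewrite /n; lia). have a2 := hN2 n ltac:(rewrite /n; lia).
have [_ a3] := hm n. have a4 := hd y hy. have a5 := hp n.
have a6 : norm (minus x (m n)) < norm (minus x y) + g / 2.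
  apply: Rsqr_incrst_0; rewrite ?Rsqr_pow2; have := norm_ge_0 (minus x y);
   have := norm_ge_0 (minus x (m n)); nra.
have := norm_minus_triangle x (m n) p. rewrite (norm_minus_sym (m n)).
have a7 : 2 * (/ 2) ^ n / (1 - / 2) = 4 * (/ 2) ^ n by field.
rewrite /g in a1 a6. lra.
Qed.

Lemma orthogonal_projection M x : closed_subspace M ->
  exists p, M p /\ forall m, M m -> inner (minus x p) m = RtoC 0.
Proof.
move=> hM. case: (nearest_point M x hM) => p [hp hmin]. exists p; split => // m hm.
set q := minus x p.
(* Moving p by t <q, m> m cannot bring it closer to x, so 2 t |<q, m>|^2 <= t^2 |<q, m>|^2 |m|^2. As
   t |m|^2 <= 1, this forces <q, m> = 0; the added 1 covers m = 0. *)
set t := / (norm m ^ 2 + 1).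
have n0 := pow2_ge_0 (norm m).
have t0 : 0 < t by apply: Rinv_0_lt_compat; lra.
have h1 : norm q <= norm (minus q (scal (Cmult (RtoC t) (inner q m)) m)).
  have -> : minus q (scal (Cmult (RtoC t) (inner q m)) m) =
    minus x (plus p (scal (Cmult (RtoC t) (inner q m)) m)) by rewrite /q; vec; ring.
  apply: hmin. apply: subspace_plus => //. exact: subspace_scal.
have h2 : norm q ^ 2 <= norm (minus q (scal (Cmult (RtoC t) (inner q m)) m)) ^ 2.
  apply: pow_incr; split => //; exact: norm_ge_0.
move: h2. rewrite norm_sqr_minus norm_scal_eq Cmod_mult Cmod_R Rabs_pos_eq; last lra.
rewrite inner_scal_r.
have -> : fst (Cconj (RtoC t * inner q m) * inner q m)%C = t * Cmod (inner q m) ^ 2.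
  rewrite Cmod_sqr /=. ring.
move=> h2.
have tm : t * norm m ^ 2 <= 1.
  rewrite /t. apply: (Rmult_le_reg_l (norm m ^ 2 + 1)); first lra.
  rewrite -Rmult_assoc Rinv_r; lra.
have c0 := pow2_ge_0 (Cmod (inner q m)).
apply: Cmod_eq_0.
have : t * Cmod (inner q m) ^ 2 <= 0.
  have : t * Cmod (inner q m) ^ 2 * (t * norm m ^ 2) <= t * Cmod (inner q m) ^ 2 * 1.
    apply: Rmult_le_compat_l => //. apply: Rmult_le_pos => //. lra.
  move: h2. lra.
move=> h3. have h4 : Cmod (inner q m) ^ 2 <= 0.
  apply: (Rmult_le_reg_l t) => //. lra.
have := Cmod_ge_0 (inner q m). nra.
Qed.

Lemma riesz (phi : H -> C) :
  (forall x y, phi (plus x y) = Cplus (phi x) (phi y)) ->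
  (forall a x, phi (scal a x) = Cmult a (phi x)) ->
  (exists K, 0 < K /\ forall x, Cmod (phi x) <= K * norm x) ->
  exists z, forall x, phi x = inner x z.
Proof.
move=> hp hs [K [K0 hK]].
have hm x y : phi (minus x y) = Cminus (phi x) (phi y).
  have -> : minus x y = plus x (scal (Copp (RtoC 1)) y) by vec; ring.
  rewrite hp hs. ring.
case: (classic (exists x0, phi x0 <> RtoC 0)) => [[x0 h0]|hn]; last first.
  exists zero => x. rewrite inner_zero_r. apply: NNPP => h. by apply: hn; exists x.
have hM : closed_subspace (fun x => phi x = RtoC 0).
  split.
  - have -> : (zero : H) = scal (RtoC 0) zero by vec; ring.
    rewrite hs; ring.
  - move=> x y hx hy. rewrite hp hx hy; ring.
  - move=> a x hx. rewrite hs hx; ring.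
  - move=> u l hu ul. apply: Cmod_eq_0. apply: Rle_antisym; last exact: Cmod_ge_0.
    apply: le_epsilon => eps e0. rewrite Rplus_0_l.
    case: (ul (eps / K)); first exact: Rdiv_lt_0_compat.
    move=> N hN. have h1 := hN N (le_n N).
    have h2 := hK (minus (u N) l).
    have h3 : phi (minus (u N) l) = Copp (phi l) by rewrite hm hu; ring.
    rewrite h3 Cmod_opp in h2.
    apply: Rle_trans h2 _. apply: (Rle_trans _ (K * (eps / K))); last by right; field; lra.
    apply: Rmult_le_compat_l; lra.
case: (orthogonal_projection _ x0 hM) => p [hp0 hq].
set q := minus x0 p in hq.
have q0 : phi q <> RtoC 0.
  rewrite /q hm hp0. move=> h; apply: h0. rewrite -h. ring.
have nq : inner q q <> RtoC 0.
  move=> /inner_self_zero h. apply: q0. rewrite h.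
  exact: (subspace_zero _ hM).
(* q is orthogonal to ker phi, and phi(q) x - phi(x) q lies in ker phi; pairing the two gives phi(x)
   = <x, q> phi(q) / <q, q>. *)
exists (scal (Cconj (phi q / inner q q)) q) => x.
have h : inner q (minus (scal (phi q) x) (scal (phi x) q)) = RtoC 0.
  apply: hq. rewrite hm !hs. ring.
apply inner_sym_zero in h. rewrite inner_minus_l !inner_scal in h.
rewrite inner_scal_r Cconj_conj.
have h' : (phi q * inner x q = phi x * inner q q)%C.
  have -> : (phi q * inner x q = (phi q * inner x q - phi x * inner q q) + phi x * inner q q)%C
    by ring.
  rewrite h; ring.
have -> : (phi q / inner q q * inner x q = (phi q * inner x q) / inner q q)%C by rewrite /Cdiv;
  ring.
rewrite h'. by field.
Qed.

Lemma adjoint_spec T : is_linear T -> forall x y, inner (T x) y = inner x (adjoint T y).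
Proof.
move=> hT x y. move: x. rewrite /adjoint.
apply: (iota_correct (fun z : H => forall x, inner (T x) y = inner x z)).
case: (riesz (fun x => inner (T x) y)).
- move=> u v. by rewrite linear_plus // inner_plus.
- move=> a u. by rewrite linear_scal // inner_scal.
- case: (linear_norm T hT) => K [K0 hK]. exists (K * (norm y + 1)); split.
    have := norm_ge_0 y; nra.
  move=> u. apply: Rle_trans (cauchy_schwarz _ _) _.
  have := hK u. have := norm_ge_0 y. have := norm_ge_0 u. nra.
move=> z hz. exists z; split => // z' hz'.
apply: inner_ext => w. rewrite inner_conj -hz hz' -inner_conj. done.
Qed.

End Projection.

(** * The bounded inverse theorem *)

Section BoundedInverse.
Context {H : HilbertSpace}.
Implicit Types (x y z w : H) (A B T : H -> H).

(** Since 2 <v, w> = <x + v, w> - <x - v, w>, one of the two terms on the right has modulus at least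
    |<v, w>|. *)
Lemma one_sign_large x v w :
  exists s : H, norm (minus s x) = norm v /\ Cmod (inner v w) <= Cmod (inner s w).
Proof.
case: (Rle_dec (Cmod (inner v w)) (Cmod (inner (plus x v) w))) => h.
  exists (plus x v); split => //. congr norm. vec; ring.
exists (minus x v); split.
  rewrite -(norm_opp v). congr norm. vec; ring.
move: h; rewrite inner_plus inner_minus_l. set a := inner x w; set b := inner v w.
have := Cmod_triangle (a + b)%C (Copp (a - b)%C).
have -> : (a + b + - (a - b) = RtoC 2 * b)%C by ring.
rewrite Cmod_opp Cmod_mult Cmod_R Rabs_pos_eq; last lra.
lra.
Qed.

(* Sokal's argument: along w_n in W with |w_n| > 4^n, steps of length 3^-n build
   a point x with |<x, w_n>| >= 3^-n |w_n| / 2. *)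
Lemma uniform_boundedness (W : H -> Prop) :
  (forall x, exists c, forall w, W w -> Cmod (inner x w) <= c) ->
  exists K, forall w, W w -> norm w <= K.
Proof.
move=> hW. apply: NNPP => hn.
have large n : exists w, W w /\ 4 ^ n < norm w.
  apply: NNPP => h. apply: hn. exists (4 ^ n) => w hw. apply: Rnot_lt_le => hlt.
  by apply: h; exists w.
pose w n := proj1_sig (constructive_indefinite_description _ (large n)).
have hw n : W (w n) /\ 4 ^ n < norm (w n).
  exact: (proj2_sig (constructive_indefinite_description _ (large n))).
pose v n : H := scal (RtoC ((/ 3) ^ n / norm (w n))) (w n).
have p4 n : 0 < 4 ^ n by apply: pow_lt; lra.
have p3 n : 0 < (/ 3) ^ n by apply: pow_lt; lra.
have w0 n : 0 < norm (w n) by have := p4 n; have := proj2 (hw n); lra.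
have nv n : norm (v n) = (/ 3) ^ n.
  rewrite /v norm_scal_eq Cmod_R Rabs_pos_eq.
    field. have := w0 n; lra.
  apply: Rlt_le; exact: Rdiv_lt_0_compat.
have iv n : Cmod (inner (v n) (w n)) = (/ 3) ^ n * norm (w n).
  rewrite /v inner_scal inner_norm Cmod_mult !Cmod_R !Rabs_pos_eq.
  - field. have := w0 n; lra.
  - exact: pow2_ge_0.
  - apply: Rlt_le; exact: Rdiv_lt_0_compat.
pose next x n := proj1_sig (constructive_indefinite_description _ (one_sign_large x (v n) (w n))).
have hnext x n : norm (minus (next x n) x) = norm (v n) /\
    Cmod (inner (v n) (w n)) <= Cmod (inner (next x n) (w n)).
  exact: (proj2_sig (constructive_indefinite_description _ (one_sign_large x (v n) (w n)))).
pose x := fix x n := if n is S m then next (x m) m else zero.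
have step n : norm (minus (x (S n)) (x n)) <= 1 * (/ 3) ^ n.
  rewrite /= (proj1 (hnext _ _)) nv. lra.
case: (geometric_conv x 1 (/ 3) ltac:(lra) ltac:(lra) step) => l [_ hl].
case: (hW l) => c hc.
(* The steps after x_(n+1) add up to at most 3^-n / 2, so c >= |<l, w_n>| >= 3^-n |w_n| / 2 >
   (4/3)^n / 2, which is unbounded. *)
case: (Pow_x_infinity (4 / 3) _ (2 * c + 1)); first by rewrite Rabs_pos_eq; lra.
move=> n /(_ n (le_n n)). rewrite Rabs_pos_eq; last by apply: pow_le; lra.
have h1 := hc _ (proj1 (hw n)).
have h2 := proj2 (hnext (x n) n). rewrite iv -/(x (S n)) in h2.
have h3 := cauchy_schwarz (minus (x (S n)) l) (w n).
have h4 := hl (S n). rewrite norm_minus_sym in h4.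
have h5 : Cmod (inner (x (S n)) (w n)) <=
    Cmod (inner (minus (x (S n)) l) (w n)) + Cmod (inner l (w n)).
  have -> : inner (x (S n)) (w n) = Cplus (inner (minus (x (S n)) l) (w n)) (inner l (w n)).
    rewrite inner_minus_l; ring.
  exact: Cmod_triangle.
have h6 : 1 * (/ 3) ^ S n / (1 - / 3) = (/ 3) ^ n / 2 by rewrite /=; field.
rewrite h6 in h4.
have h7 : norm (minus (x (S n)) l) * norm (w n) <= (/ 3) ^ n / 2 * norm (w n).
  apply: Rmult_le_compat_r => //. exact: norm_ge_0.
have h8 : (4 / 3) ^ n = (/ 3) ^ n * 4 ^ n by rewrite -Rpow_mult_distr; congr pow; field.
have h9 : (/ 3) ^ n * 4 ^ n < (/ 3) ^ n * norm (w n).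
  apply: Rmult_lt_compat_l => //. exact: (proj2 (hw n)).
lra.
Qed.

Lemma adjoint_plus A : is_linear A -> forall x y, adjoint A (plus x y) = plus (adjoint A x)
  (adjoint A y).
Proof.
move=> hA x y. apply: inner_ext => z.
rewrite inner_conj -adjoint_spec // [RHS]inner_conj !inner_plus_r -!adjoint_spec //.
Qed.

Lemma adjoint_scal A : is_linear A -> forall a x, adjoint A (scal a x) = scal a (adjoint A x).
Proof.
move=> hA a x. apply: inner_ext => z.
rewrite inner_conj -adjoint_spec // [RHS]inner_conj !inner_scal_r -!adjoint_spec //.
Qed.

(** If q is orthogonal to the range of the adjoint B of A, then |A q|^2 = <q, B A q> = 0, and
    injectivity gives q = 0. This is applied to the part of x orthogonal to the closure [L] of that
    range. *)
Lemma adjoint_range_dense A : is_linear A -> (forall x, A x = zero -> x = zero) ->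
  forall x eps, 0 < eps -> exists w, norm (minus (adjoint A w) x) < eps.
Proof.
move=> hA inj.
set L := fun x => forall eps, 0 < eps -> exists w, norm (minus (adjoint A w) x) < eps.
have hL : closed_subspace L.
  split.
  - move=> eps e0. exists (zero : H).
    have -> : adjoint A zero = zero.
      have -> : (zero : H) = scal (RtoC 0) zero by vec; ring.
      rewrite adjoint_scal //. vec; ring.
    have -> : minus (zero : H) zero = zero by exact: minus_eq_zero.
    by rewrite norm_zero.
  - move=> x y hx hy eps e0.
    case: (hx (eps / 2)); first lra. move=> w1 h1.
    case: (hy (eps / 2)); first lra. move=> w2 h2.
    exists (plus w1 w2). rewrite adjoint_plus //.
    have -> : minus (plus (adjoint A w1) (adjoint A w2)) (plus x y) =
      plus (minus (adjoint A w1) x) (minus (adjoint A w2) y) by vec; ring.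
    apply: Rle_lt_trans (norm_triangle _ _) _. lra.
  - move=> a x hx eps e0.
    have c0 := Cmod_ge_0 a.
    case: (hx (eps / (Cmod a + 1))); first by apply: Rdiv_lt_0_compat; lra.
    move=> w h. exists (scal a w). rewrite adjoint_scal //.
    have -> : minus (scal a (adjoint A w)) (scal a x) = scal a (minus (adjoint A w) x) by vec; ring.
    rewrite norm_scal_eq. have n0 := norm_ge_0 (minus (adjoint A w) x).
    have h1 : (Cmod a + 1) * norm (minus (adjoint A w) x) < (Cmod a + 1) * (eps / (Cmod a + 1)).
      apply: Rmult_lt_compat_l => //; lra.
    have h2 : (Cmod a + 1) * (eps / (Cmod a + 1)) = eps by field; lra.
    rewrite h2 in h1. lra.
  - move=> u l hu ul eps e0.
    case: (ul (eps / 2)); first lra. move=> N hN.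
    case: (hu N (eps / 2)); first lra. move=> w hw. exists w.
    have := norm_minus_triangle (adjoint A w) (u N) l. have := hN N (le_n N). lra.
move=> x. case: (orthogonal_projection L x hL) => p [hp ho].
suff -> : x = p by [].
apply: minus_zero. apply: inj. apply: inner_self_zero.
rewrite adjoint_spec //. apply: ho => eps e0.
exists (A (minus x p)).
have -> : minus (adjoint A (A (minus x p))) (adjoint A (A (minus x p))) = zero by exact:
  minus_eq_zero.
by rewrite norm_zero.
Qed.

(* Surjectivity makes the adjoint bounded below by uniform boundedness; injectivity
   makes its range dense, which transfers the lower bound to A. *)
Theorem bounded_below_of_bijective A : is_linear A -> (forall x, A x = zero -> x = zero) ->
  (forall y, exists x, A x = y) ->
  exists K, 0 < K /\ forall x, norm x <= K * norm (A x).
Proof.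
move=> hA inj surj.
case: (uniform_boundedness (fun w => norm (adjoint A w) <= 1)).
  move=> y. case: (surj y) => x <-. exists (norm x) => w hw.
  rewrite adjoint_spec //. apply: Rle_trans (cauchy_schwarz _ _) _.
  have := norm_ge_0 x. nra.
move=> K0 hK0.
set K := Rabs K0 + 1.
have K1 : 0 < K by rewrite /K; have := Rabs_pos K0; lra.
have hK w : norm (adjoint A w) <= 1 -> norm w <= K.
  move=> h. have := hK0 w h. have := Rle_abs K0. rewrite /K; lra.
have hA' w c : 0 < c -> norm (adjoint A w) <= c -> norm w <= K * c.
  move=> c0 h. have := hK (scal (RtoC (/ c)) w).
  rewrite adjoint_scal // !norm_scal_eq Cmod_R Rabs_pos_eq; last by apply: Rlt_le; exact:
    Rinv_0_lt_compat.
  have i0 := Rinv_0_lt_compat _ c0.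
  move=> h1. have h2 : / c * norm w <= K.
    apply: h1. apply: (Rmult_le_reg_l c) => //. rewrite -Rmult_assoc Rinv_r; lra.
  apply: (Rmult_le_reg_l (/ c)) => //.
  have -> : / c * (K * c) = K by field; lra. done.
exists K; split => // x.
case: (Req_dec (norm x) 0) => [h|h].
  rewrite h. have := norm_ge_0 (A x) => na. have := Rmult_le_pos K _ (Rlt_le _ _ K1) na. lra.
have x0 : 0 < norm x by have := norm_ge_0 x; lra.
apply: le_epsilon => eps e0.
(* Approximating x with relative error d costs d (|x| + K |A x|) in the final estimate, which this
   choice makes equal to eps. *)
set d := eps / (norm x + K * norm (A x)).
have na := norm_ge_0 (A x).
have d0 : 0 < norm x + K * norm (A x) by have := Rmult_le_pos K _ (Rlt_le _ _ K1) na; lra.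
have dp : 0 < d * norm x by apply: Rmult_lt_0_compat => //; exact: Rdiv_lt_0_compat.
have d1 : 0 < d by exact: Rdiv_lt_0_compat.
case: (adjoint_range_dense A hA inj x (d * norm x) dp) => w hw.
have h1 : norm (adjoint A w) <= (1 + d) * norm x.
  have -> : adjoint A w = plus (minus (adjoint A w) x) x by vec; ring.
  apply: Rle_trans (norm_triangle _ _) _. lra.
have h2 : norm w <= K * ((1 + d) * norm x) by apply: hA' => //; apply: Rmult_lt_0_compat; lra.
have h3 : norm x ^ 2 <= norm (A x) * norm w + norm x * (d * norm x).
  have -> : norm x ^ 2 = Cmod (inner x x).
    rewrite inner_norm Cmod_R Rabs_pos_eq //. exact: pow2_ge_0.
  have -> : inner x x = Cplus (inner (A x) w) (Copp (inner x (minus (adjoint A w) x))).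
    rewrite adjoint_spec // inner_minus_r; ring.
  apply: Rle_trans (Cmod_triangle _ _) _. rewrite Cmod_opp.
  have := cauchy_schwarz (A x) w. have := cauchy_schwarz x (minus (adjoint A w) x).
  have := norm_ge_0 x. nra.
have h4 : norm (A x) * norm w <= norm (A x) * (K * ((1 + d) * norm x)) by apply: Rmult_le_compat_l.
have h5 : norm x <= K * norm (A x) * (1 + d) + d * norm x.
  have e : d * norm x ^ 2 = norm x * (d * norm x) by ring.
  apply: (Rmult_le_reg_l (norm x)) => //. lra.
have h6 : d * (norm x + K * norm (A x)) = eps by rewrite /d; field; lra.
lra.
Qed.

Theorem bijective_invertible A : is_linear A -> (forall x, A x = zero -> x = zero) ->
  (forall y, exists x, A x = y) -> invertible A.
Proof.
move=> hA inj surj.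
pose B y := proj1_sig (constructive_indefinite_description _ (surj y)).
have hB y : A (B y) = y by exact: (proj2_sig (constructive_indefinite_description _ (surj y))).
have inj' x y : A x = A y -> x = y.
  move=> h. apply: minus_zero. apply: inj. rewrite linear_minus // h. exact: minus_eq_zero.
exists B; split; last by move=> x; split => //; apply: inj'.
split.
- move=> x y. apply: inj'. by rewrite (linear_plus A) // !hB.
- move=> a x. apply: inj'. by rewrite (linear_scal A) // !hB.
- case: (bounded_below_of_bijective A hA inj surj) => K [K0 hK].
  exists K; split => // y. by rewrite -{2}(hB y); apply: hK.
Qed.

End BoundedInverse.

(** * The spectral projection and the Drazin inverse *)

Section Decomposition.
Context {H : HilbertSpace}.
Implicit Types (x y z u v w : H) (A B N P D T : H -> H).

Lemma is_linear_add A B : is_linear A -> is_linear B -> is_linear (fun x => plus (A x) (B x)).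
Proof.
move=> hA hB. split.
- move=> x y. rewrite (linear_plus A) // (linear_plus B) //. vec; ring.
- move=> a x. rewrite (linear_scal A) // (linear_scal B) //. vec; ring.
- case: (linear_norm A hA) => K [K0 hK]. case: (linear_norm B hB) => L [L0 hL].
  exists (K + L); split; first lra. move=> x. apply: Rle_trans (norm_triangle _ _) _.
  have := hK x. have := hL x. lra.
Qed.

Lemma is_linear_scale a A : is_linear A -> is_linear (fun x => scal a (A x)).
Proof.
move=> hA. split.
- move=> x y. rewrite (linear_plus A) //. vec; ring.
- move=> b x. rewrite (linear_scal A) //. vec; ring.
- case: (linear_norm A hA) => K [K0 hK].
  have c0 := Cmod_ge_0 a. exists (K * (Cmod a + 1)); split; first by apply: Rmult_lt_0_compat; lra.
  move=> x. rewrite norm_scal_eq. have := hK x. have nx := norm_ge_0 x. have := norm_ge_0 (A x).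
  have := Rmult_le_compat_l _ _ _ c0 (hK x). have := Rmult_le_pos _ _ (Rlt_le _ _ K0) nx.
  have -> : K * (Cmod a + 1) * norm x = Cmod a * (K * norm x) + K * norm x by ring. lra.
Qed.

Lemma is_linear_sub A B : is_linear A -> is_linear B -> is_linear (fun x => minus (A x) (B x)).
Proof.
move=> hA hB. apply: is_linear_add => //.
apply: (is_linear_ext (fun x => scal (Copp (RtoC 1)) (B x))); last exact: is_linear_scale.
move=> x. vec; ring.
Qed.

Lemma is_linear_shift T l : is_linear T -> is_linear (shift T l).
Proof. move=> hT. apply: is_linear_sub => //. apply: is_linear_scale. exact: is_linear_id. Qed.

Lemma is_linear_power T n : is_linear T -> is_linear (power T n).
Proof.
move=> hT. elim: n => [|n IH]; first exact: is_linear_id. exact: is_linear_comp IH hT.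
Qed.

Lemma power_add T m n x : power T (m + n) x = power T m (power T n x).
Proof. by elim: m => //= m IH; rewrite /power /= -/(power T (m + n) x) IH. Qed.

Lemma power_S_r T n x : power T (S n) x = power T n (T x).
Proof. by rewrite -Nat.add_1_r power_add. Qed.

Lemma power_comm A B n x : (forall x, A (B x) = B (A x)) -> A (power B n x) = power B n (A x).
Proof. move=> h. by elim: n => //= n IH; rewrite /power /= h -/(power B n x) IH. Qed.

Lemma null_closed_subspace A : is_linear A -> closed_subspace (null A).
Proof.
move=> hA. split; rewrite /null.
- exact: linear_zero.
- move=> x y hx hy. by rewrite linear_plus // hx hy plus_zero_l.
- move=> a x hx. by rewrite linear_scal // hx scal_zero_r.
- move=> u l hu ul. apply: (conv_unique (fun n => A (u n))); first exact: conv_linear.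
  move=> eps e0. exists O => n _. by rewrite hu minus_eq_zero norm_zero.
Qed.

Lemma orthogonal_projector M : closed_subspace M ->
  exists Q : H -> H, is_linear Q /\ (forall x, M (Q x)) /\ (forall x, M x -> Q x = x).
Proof.
move=> hM.
pose Q x := proj1_sig (constructive_indefinite_description _ (orthogonal_projection M x hM)).
have hQ x : M (Q x) /\ forall m, M m -> inner (minus x (Q x)) m = RtoC 0.
  exact: (proj2_sig (constructive_indefinite_description _ (orthogonal_projection M x hM))).
(* Linearity of Q comes from this uniqueness: sums and multiples of projections satisfy the same
   characterization. *)
have uni x p : M p -> (forall m, M m -> inner (minus x p) m = RtoC 0) -> Q x = p.
  move=> hp ho. case: (hQ x) => h1 h2.
  have hm : M (minus (Q x) p) by apply: subspace_minus.
  apply: minus_zero. apply: inner_self_zero.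
  have -> : inner (minus (Q x) p) (minus (Q x) p) =
    Cminus (inner (minus x p) (minus (Q x) p)) (inner (minus x (Q x)) (minus (Q x) p)).
    rewrite -inner_minus_l. congr inner. vec; ring.
  rewrite ho // h2 //. ring.
exists Q; split; last first.
  split; first by move=> x; exact: (proj1 (hQ x)).
  move=> x hx. apply: uni => // m _. by rewrite minus_eq_zero inner_zero_l.
split.
- move=> x y. case: (hQ x) => x1 x2. case: (hQ y) => y1 y2. apply: uni.
    exact: subspace_plus.
  move=> m hm.
  have -> : minus (plus x y) (plus (Q x) (Q y)) = plus (minus x (Q x)) (minus y (Q y)) by vec; ring.
  rewrite inner_plus x2 // y2 //. ring.
- move=> a x. case: (hQ x) => x1 x2. apply: uni.
    exact: subspace_scal.
  move=> m hm.
  have -> : minus (scal a x) (scal a (Q x)) = scal a (minus x (Q x)) by vec; ring.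
  rewrite inner_scal x2 //. ring.
- exists 1; split; first lra. move=> x. rewrite Rmult_1_l.
  case: (hQ x) => x1 x2.
  have h : norm x ^ 2 = norm (minus x (Q x)) ^ 2 + norm (Q x) ^ 2.
    have {1}-> : x = plus (minus x (Q x)) (Q x) by vec; ring.
    rewrite norm_sqr_plus x2 //=. ring.
  apply: Rsqr_incr_0; [| exact: norm_ge_0 | exact: norm_ge_0].
  rewrite !Rsqr_pow2. have := pow2_ge_0 (norm (minus x (Q x))). lra.
Qed.

(* With Q the orthogonal projection onto the kernel, A + Q is bijective, hence has a
   bounded inverse B, and P = Q B. *)
Lemma projector_onto_null A : is_linear A ->
  (forall x, A (A x) = zero -> A x = zero) ->
  (forall y, exists u v, A v = zero /\ y = plus (A u) v) ->
  exists P, is_linear P /\ (forall x, A (P x) = zero) /\ (forall x, A x = zero -> P x = x) /\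
    (forall x, P (A x) = zero) /\ (forall x, exists u, minus x (P x) = A u).
Proof.
move=> hA dis sum.
case: (orthogonal_projector (null A) (null_closed_subspace A hA)) => Q [hQ [Q1 Q2]].
rewrite /null in Q1 Q2.
have decomp r k : A r = zero -> A k = zero -> (exists u, r = A u) -> r = zero.
  move=> h _ [u hu]. rewrite hu. apply: dis. by rewrite -hu.
case: (bijective_invertible (fun x => plus (A x) (Q x))).
- exact: is_linear_add.
- move=> x hx.
  have h1 : A (A x) = zero.
    have : A (plus (A x) (Q x)) = zero by rewrite hx; exact: linear_zero.
    by rewrite linear_plus // Q1 plus_zero_r.
  have h2 := dis _ h1. rewrite h2 plus_zero_l in hx. by rewrite -(Q2 x h2).
- move=> y. case: (sum y) => u [v [hv ->]].
  exists (plus (minus u (Q u)) v).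
  rewrite (linear_plus A) // (linear_plus Q) // (linear_minus A) // (linear_minus Q) //.
  rewrite Q1 hv (Q2 (Q u)) // (Q2 v) //. vec; ring.
move=> Psi [hPsi inv].
(* A + Q maps u - Q u + v to A u + v, and Q maps u - Q u + v to v. So Q Psi is the projection onto
   ker A along R(A). *)
have val u v : A v = zero -> Q (Psi (plus (A u) v)) = v.
  move=> hv. have -> : plus (A u) v = plus (A (plus (minus u (Q u)) v)) (Q (plus (minus u (Q u))
    v)).
    rewrite (linear_plus A) // (linear_plus Q) // (linear_minus A) // (linear_minus Q) //.
    rewrite Q1 hv (Q2 (Q u)) // (Q2 v) //. vec; ring.
  rewrite (proj1 (inv _)) linear_plus // linear_minus // (Q2 (Q u)) // (Q2 v) //. vec; ring.
exists (fun x => Q (Psi x)); split; first exact: is_linear_comp.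
split=> //. split.
  move=> x hx. have {1}-> : x = plus (A zero) x by rewrite linear_zero // plus_zero_l.
  exact: val.
split.
  move=> x. rewrite -{1}(plus_zero_r (A x)). apply: val. exact: linear_zero.
move=> x. case: (sum x) => u [v [hv ->]]. exists u. rewrite val //. vec; ring.
Qed.

(** Inverts 1 + N on ker N^n without writing the finite Neumann series: solve for - N v, which
    N^(n-1) kills, and add v to the solution. *)
Lemma nilpotent_one_plus_surjective N n v : is_linear N -> power N n v = zero ->
  exists w, power N n w = zero /\ plus (N w) w = v.
Proof.
move=> hN. elim: n v => [|n IH] v hv.
  exists zero. split => //. rewrite (linear_zero N) // plus_zero_l. by rewrite -hv.
case: (IH (opp (N v))).
  rewrite linear_opp; last exact: is_linear_power. rewrite -power_S_r hv. exact: opp_zero.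
move=> w [w1 w2]. exists (plus w v); split.
  rewrite linear_plus; last exact: is_linear_power. rewrite hv plus_zero_r.
  by rewrite /power /= -/(power N n w) w1 linear_zero.
rewrite (linear_plus N) //.
have -> : plus (plus (N w) (N v)) (plus w v) = plus (plus (plus (N w) w) (N v)) v by vec; ring.
rewrite w2. vec; ring.
Qed.

Lemma nilpotent_one_plus_injective N n v : is_linear N -> power N n v = zero ->
  plus (N v) v = zero -> v = zero.
Proof.
move=> hN hv h. have e : N v = opp v.
  have -> : N v = minus (plus (N v) v) v by vec; ring. rewrite h. vec; ring.
elim: n hv => [|n IH] // hv. apply: IH.
move: hv. rewrite power_S_r e linear_opp; last exact: is_linear_power.
move=> h'. by rewrite -(opp_opp (power N n v)) h' opp_zero.
Qed.

(* P is the spectral projection and D the Drazin inverse. *)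
Lemma drazin N d : is_linear N ->
  (forall x, range (power N d) x -> N x = zero -> x = zero) ->
  (forall y, range (power N d) y -> range (power N (S d)) y) ->
  exists P D, is_linear P /\ is_linear D /\
    (forall x, power N d (P x) = zero) /\
    (forall x, power N d x = zero -> P x = x) /\
    (forall x, N (P x) = P (N x)) /\
    (forall x, N (D x) = minus x (P x)) /\
    (forall x, D (N x) = minus x (P x)) /\
    (forall x, P (D x) = zero).
Proof.
move=> hN inj surj.
have lA n : is_linear (power N n) by exact: is_linear_power.
have asc k x : power N (k + d) x = zero -> power N d x = zero.
  elim: k x => [|k IH] x //. move=> h. apply: (IH).
  apply: inj => //. exists (power N k x). by rewrite -power_add Nat.add_comm.
have lift y : range (power N d) y -> exists x, range (power N d) x /\ N x = y.
  move=> hy. case: (surj y hy) => u <-. exists (power N d u); split => //. by exists u.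
have desc k y : range (power N d) y -> exists x, range (power N d) x /\ power N k x = y.
  elim: k y => [|k IH] y hy; first by exists y.
  case: (lift y hy) => x [hx <-]. case: (IH x hx) => x' [hx' <-]. by exists x'.
set A := power N d.
have NA x : N (A x) = A (N x) by apply: power_comm.
(* Injectivity of N on R(N^d) gives ker N^(2d) = ker N^d, and surjectivity gives H = R(N^d) + ker
   N^d. *)
case: (projector_onto_null A (lA d)).
- move=> x h. apply: (asc d). by rewrite power_add.
- move=> y. case: (desc d (A y)); first by exists y.
  move=> x [[u hu] hx]. exists u, (minus y x); split.
    rewrite (linear_minus A); last exact: lA. rewrite {2}/A hx. exact: minus_eq_zero.
  rewrite /A hu. vec; ring.
move=> P [lP [P1 [P2 [P3 P4]]]].
have PN x : N (P x) = P (N x).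
  case: (P4 x) => u hu.
  have -> : P (N x) = P (plus (A (N u)) (N (P x))).
    congr P. rewrite -NA -hu -(linear_plus N) //. congr N. vec; ring.
  rewrite (linear_plus P) // P3 plus_zero_l (P2 (N (P x))) //. by rewrite -NA P1 linear_zero.
(* N + P acts as N on R(N^d) and as 1 + N, with N nilpotent, on ker N^d; it is bijective on both.
   With B its inverse, D = B (1 - P). *)
case: (bijective_invertible (fun x => plus (N x) (P x))).
- exact: is_linear_add.
- move=> x hx. case: (P4 x) => u hu.
  have ex : x = plus (A u) (P x) by rewrite -hu; vec; ring.
  have Pz : plus (N (P x)) (P x) = zero.
    have <- : P (plus (N x) (P x)) = plus (N (P x)) (P x).
      by rewrite (linear_plus P) // PN (P2 (P x)).
    rewrite hx. exact: linear_zero.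
  have Px0 : P x = zero by apply: (nilpotent_one_plus_injective N d).
  rewrite Px0 plus_zero_r in hx. apply: inj => //. exists u. by rewrite -/A -hu Px0; vec; ring.
- move=> y. case: (P4 y) => u hu.
  case: (lift (A u)); first by exists u.
  move=> r [[s hs] hr].
  case: (nilpotent_one_plus_surjective N d (P y) hN (P1 y)) => w [w1 w2].
  exists (plus r w). rewrite (linear_plus N) // (linear_plus P) // hr.
  have -> : P r = zero by rewrite -hs; exact: P3.
  rewrite (P2 w) //.
  have -> : plus (plus (A u) (N w)) (plus zero w) = plus (A u) (plus (N w) w) by vec; ring.
  rewrite w2 -hu. vec; ring.
move=> B [lB inv].
have BP x : B (P x) = P (B x).
  have {1}-> : P x = plus (N (P (B x))) (P (P (B x))).
    rewrite -{1}(proj2 (inv x)) linear_plus // PN //.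
  exact: (proj1 (inv _)).
have PP x : P (P x) = P x by apply: P2.
have P0 x : P (minus x (P x)) = zero by rewrite linear_minus // PP; exact: minus_eq_zero.
have PD x : P (B (minus x (P x))) = zero by rewrite -BP P0; exact: linear_zero.
exists P, (fun x => B (minus x (P x))); split => //; split.
  apply: (is_linear_comp (fun x => minus x (P x)) B) => //. apply: is_linear_sub => //. exact:
    is_linear_id.
do 3 (split => //). split.
  move=> x. rewrite -{2}(proj2 (inv (minus x (P x)))) PD. vec; ring.
split => //.
move=> x. rewrite -PN -linear_minus //.
rewrite -[RHS](proj1 (inv (minus x (P x)))) P0. by rewrite plus_zero_r.
Qed.

End Decomposition.

(** * The Laurent expansion of the resolvent *)

Section Laurent.
Context {H : HilbertSpace}.
Implicit Types (x y z u v : H) (A B N P D T S : H -> H) (l w : C).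

Lemma resolvent_unique T (c : C) x y : invertible (shift T c) ->
  minus (scal c x) (T x) = y -> resolvent T c y = x.
Proof.
move=> [B [hB inv]] h. apply: iota_unique => // x' h'.
have e : shift T c x = opp y by rewrite /shift -h; vec; ring.
have e' : shift T c x' = opp y by rewrite /shift -h'; vec; ring.
by rewrite -(proj1 (inv x)) -(proj1 (inv x')) e e'.
Qed.

Lemma resolvent_spec T (c : C) y : invertible (shift T c) ->
  minus (scal c (resolvent T c y)) (T (resolvent T c y)) = y.
Proof.
move=> h. case: (h) => [B [hB inv]].
have e : minus (scal c (B (opp y))) (T (B (opp y))) = y.
  have -> : minus (scal c (B (opp y))) (T (B (opp y))) = opp (shift T c (B (opp y))).
    rewrite /shift. vec; ring.
  by rewrite (proj2 (inv (opp y))) opp_opp.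
by rewrite (resolvent_unique T c _ y h e).
Qed.

Lemma shift_shift T l (z : C) x : shift T z x = minus (shift T l x) (scal (z - l)%C x).
Proof. rewrite /shift. vec; ring. Qed.

(** Coefficient of w^j in w^d (w - N)^-1: multiplying by w^d turns the Laurent series into a power
    series, with the principal part at the indices j < d. *)
Definition laurent_coeff N P D d (j : nat) : H -> H :=
  if (j <? d)%nat then fun x => power N (d - 1 - j) (P x)
  else fun x => opp (power D (j - d + 1) x).

Definition laurent_sum (Q : nat -> H -> H) w n x : H :=
  sum_n (fun j => scal (w ^ j)%C (Q j x)) n.

Lemma laurent_sum_S Q w n x :
  laurent_sum Q w (S n) x = plus (laurent_sum Q w n x) (scal (w ^ S n)%C (Q (S n) x)).
Proof. exact: sum_Sn. Qed.

Section Expansion.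
Variables (N P D : H -> H) (d : nat).
Hypotheses (lN : is_linear N) (lP : is_linear P) (lD : is_linear D) (d0 : (1 <= d)%nat).
Hypothesis nilP : forall x, power N d (P x) = zero.
Hypothesis ND : forall x, N (D x) = minus x (P x).
Hypothesis DN : forall x, D (N x) = minus x (P x).
Hypothesis PD : forall x, P (D x) = zero.
Hypothesis Pid : forall x, power N d x = zero -> P x = x.

Notation Q := (laurent_coeff N P D d).

Lemma laurent_coeff_linear j : is_linear (Q j).
Proof.
rewrite /laurent_coeff. case: (j <? d)%nat.
  apply: is_linear_comp => //. exact: is_linear_power.
apply: (is_linear_ext (fun x => minus zero (power D (j - d + 1) x))).
  move=> x. vec; ring.
apply: is_linear_sub; [exact: is_linear_zero | exact: is_linear_power].
Qed.

Lemma laurent_coeff_0 x : N (Q 0 x) = zero.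
Proof.
rewrite /laurent_coeff (proj2 (Nat.ltb_lt 0 d)); last lia.
rewrite -(nilP x) -{2}(Nat.sub_add 1 d) // Nat.add_1_r Nat.sub_0_r. done.
Qed.

(** This is the coefficient of w^(j+1) in (w - N) F(w) x = w^d x, where F(w) is the series with
    coefficients Q_j. *)
Lemma laurent_coeff_S j x :
  N (Q (S j) x) = minus (Q j x) (if (S j =? d)%nat then x else zero).
Proof.
rewrite /laurent_coeff. case: (Nat.eqb_spec (S j) d) => e.
  rewrite (proj2 (Nat.ltb_ge _ _)); last lia. rewrite (proj2 (Nat.ltb_lt _ _)); last lia.
  rewrite (_ : (S j - d + 1 = 1)%nat); last lia. rewrite (_ : (d - 1 - j = 0)%nat); last lia.
  rewrite /power /= linear_opp // ND. vec; ring.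
case: (Nat.ltb_spec (S j) d) => h.
  rewrite (proj2 (Nat.ltb_lt _ _)); last lia.
  rewrite (_ : (d - 1 - j = S (d - 1 - S j))%nat); last lia.
  rewrite /power /=. vec; ring.
rewrite (proj2 (Nat.ltb_ge _ _)); last lia.
rewrite (_ : (S j - d + 1 = S (S (j - d)))%nat); last lia.
rewrite (_ : (j - d + 1 = S (j - d))%nat); last lia.
rewrite /power /= linear_opp // ND PD. vec; ring.
Qed.

(** The recurrence cancels all but the last term; the source w^d x appears once the partial sum
    reaches index d. *)
Lemma laurent_telescope w n x :
  minus (scal w (laurent_sum Q w n x)) (N (laurent_sum Q w n x)) =
  plus (scal (w ^ S n)%C (Q n x)) (if (d <=? n)%nat then scal (w ^ d)%C x else zero).
Proof.
elim: n => [|n IH].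
  rewrite /laurent_sum sum_O (linear_scal N) // laurent_coeff_0.
  rewrite (proj2 (Nat.leb_gt _ _)); last lia. vec. rewrite Cpow_1_r /=. ring.
rewrite laurent_sum_S (linear_plus N) // (linear_scal N) // laurent_coeff_S.
set s := laurent_sum Q w n x in IH *.
have -> : minus (scal w (plus s (scal (w ^ S n)%C (Q (S n) x))))
   (plus (N s) (scal (w ^ S n)%C (minus (Q n x) (if (S n =? d)%nat then x else zero)))) =
   plus (minus (scal w s) (N s)) (minus (scal (w * w ^ S n)%C (Q (S n) x)) (scal (w ^ S n)%C
     (minus (Q n x) (if (S n =? d)%nat then x else zero)))).
  vec; ring.
rewrite IH -(Cpow_S w (S n)).
case: (Nat.eqb_spec (S n) d) => e.
  rewrite (proj2 (Nat.leb_gt _ _)); last lia. rewrite (proj2 (Nat.leb_le _ _)); last lia.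
  rewrite -e. vec; ring.
case: (Nat.leb_spec d n) => h.
  rewrite (proj2 (Nat.leb_le _ _)); last lia. vec; ring.
rewrite (proj2 (Nat.leb_gt _ _)); last lia. vec; ring.
Qed.

Variable K : R.
Hypothesis K1 : 1 <= K.
Hypothesis hK : forall x, norm (D x) <= K * norm x.

Lemma norm_power n x : norm (power D n x) <= K ^ n * norm x.
Proof.
elim: n => [|n IH]; first by rewrite /power /=; lra.
rewrite /power /= -/(power D n x). apply: Rle_trans (hK _) _.
rewrite Rmult_assoc. apply: Rmult_le_compat_l => //. lra.
Qed.

Lemma laurent_term_bound w k x : Cmod w <= 1 ->
  norm (scal (w ^ (d + k))%C (Q (d + k) x)) <= K * norm x * (Cmod w * K) ^ k.
Proof.
move=> w1. rewrite norm_scal_eq Cmod_pow /laurent_coeff.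
rewrite (proj2 (Nat.ltb_ge _ _)); last lia.
rewrite (_ : (d + k - d + 1 = S k)%nat); last lia.
rewrite norm_opp pow_add Rpow_mult_distr.
have h1 := norm_power (S k) x. rewrite /= in h1.
have w0 := Cmod_ge_0 w.
have h2 := pow_le _ k w0. have h3 : Cmod w ^ d <= 1.
  rewrite -(pow1 d). by apply: pow_incr.
have h4 := pow_le _ d w0.
have h5 : Cmod w ^ d * Cmod w ^ k <= Cmod w ^ k by rewrite -{2}(Rmult_1_l (Cmod w ^ k)); apply:
  Rmult_le_compat_r.
apply: (Rle_trans _ (Cmod w ^ k * (K * K ^ k * norm x))); last by right; ring.
apply: Rmult_le_compat => //.
- exact: Rmult_le_pos.
- exact: norm_ge_0.
Qed.

(** If N x = w x, then w^d P x = N^d P x = 0, so P x = 0 and x = w D x, which |w| K < 1 allows only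
    for x = 0. For surjectivity, the telescoped identity is passed to the limit. *)
Lemma shift_invertible_near w : w <> RtoC 0 -> Cmod w * K < 1 -> invertible (shift N w).
Proof.
move=> w0 wK.
have wp := Cmod_ge_0 w. have w1 : Cmod w <= 1 by nra.
apply: bijective_invertible.
- exact: is_linear_shift.
- move=> x hx.
  have e : N x = scal w x by apply: minus_zero.
  have ePn n : power N n x = scal (w ^ n)%C x.
    elim: n => [|n IH]; first by rewrite /power /=; vec; ring.
    rewrite /power /= -/(power N n x) IH (linear_scal N) // e. vec; ring.
  have DP y : D (N y) = N (D y) by rewrite ND DN.
  have dx : scal w (D x) = minus x (P x) by rewrite -(linear_scal D) // -e DN.
  have nP : P (N x) = N (P x).
    have PP : P (P x) = P x by apply: Pid.
    have PPN : power N d (N (P x)) = zero by rewrite -power_comm // nilP; exact: linear_zero.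
    have e1 : N x = plus (N (P x)) (N (minus x (P x))) by rewrite -(linear_plus N) //; congr N;
      vec; ring.
    rewrite {1}e1 (linear_plus P) // (Pid _ PPN).
    have -> : minus x (P x) = D (N x) by rewrite DN.
    by rewrite -DP PD plus_zero_r.
  have Pz : P x = zero.
    have ePP n : power N n (P x) = scal (w ^ n)%C (P x).
      elim: n => [|n IH]; first by rewrite /power /=; vec; ring.
      rewrite /power /= -/(power N n (P x)) IH (linear_scal N) // -nP e (linear_scal P) //. vec;
        ring.
    have := ePP d. rewrite nilP => h.
    have -> : P x = scal (/ w ^ d)%C (scal (w ^ d)%C (P x)).
      vec. field. exact: Cpow_nz.
    rewrite -h. exact: scal_zero_r.
  have xe : x = scal w (D x) by rewrite dx Pz; vec; ring.
  apply: norm_eq_zero.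
  have : norm x <= Cmod w * (K * norm x).
    rewrite {1}xe norm_scal_eq. apply: Rmult_le_compat_l => //.
  have nx := norm_ge_0 x. nra.
- move=> y.
  case: (geometric_conv (fun k => laurent_sum Q w (d + k) y) (K * norm y) (Cmod w * K)).
  + split => //. by apply: Rmult_le_pos; lra.
  + apply: Rmult_le_pos; [lra | exact: norm_ge_0].
  + move=> k. rewrite Nat.add_succ_r laurent_sum_S.
    have -> : minus (plus (laurent_sum Q w (d + k) y) (scal (w ^ S (d + k))%C (Q (S (d + k)) y)))
       (laurent_sum Q w (d + k) y) = scal (w ^ S (d + k))%C (Q (S (d + k)) y) by vec; ring.
    rewrite -Nat.add_succ_r. apply: Rle_trans (laurent_term_bound _ _ _ w1) _.
    rewrite /=. have c0 : 0 <= Cmod w * K by apply: Rmult_le_pos; lra.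
    have a1 := pow_le _ k c0. have a2 : 0 <= K * norm y by apply: Rmult_le_pos; [lra | exact:
      norm_ge_0].
    apply: Rmult_le_compat_l => //. nra.
  move=> x [hx _].
  (* The series sums to w^d (w - N)^-1 y, whereas [shift N w] is N - w: hence the sign and the
     division by w^d. *)
  exists (scal (- / w ^ d)%C x).
  have lS := is_linear_shift N w lN.
  have e : shift N w x = opp (scal (w ^ d)%C y).
    apply: (conv_unique (fun k => shift N w (laurent_sum Q w (d + k) y))).
      exact: conv_linear.
    move=> eps e0.
    have cK : 0 <= Cmod w * K < 1 by split => //; apply: Rmult_le_pos; lra.
    case: (pow_to_zero (Cmod w * K) (Cmod w * (K * norm y)) eps cK e0) => M hM.
    exists M => k hk.
    have := laurent_telescope w (d + k) y.
    rewrite (proj2 (Nat.leb_le _ _)); last lia.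
    move=> h.
    have -> : minus (shift N w (laurent_sum Q w (d + k) y)) (opp (scal (w ^ d)%C y)) =
      opp (scal w (scal (w ^ (d + k))%C (Q (d + k) y))).
      have -> : opp (scal w (scal (w ^ (d + k))%C (Q (d + k) y))) =
        plus (opp (plus (scal (w ^ S (d + k))%C (Q (d + k) y)) (scal (w ^ d)%C y))) (scal (w ^
          d)%C y).
        rewrite Cpow_S. vec; ring.
      rewrite -h /shift. vec; ring.
    rewrite norm_opp norm_scal_eq.
    apply: Rle_lt_trans (hM k hk). rewrite Rmult_assoc.
    apply: Rmult_le_compat_l => //. exact: laurent_term_bound.
  rewrite (linear_scal _ lS) e. vec. field. exact: Cpow_nz.
Qed.

End Expansion.

Lemma drazin_pole S l d P D : is_linear S -> spectrum S l -> (1 <= d)%nat ->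
  is_linear P -> is_linear D ->
  (forall x, power (shift S l) d (P x) = zero) ->
  (forall x, power (shift S l) d x = zero -> P x = x) ->
  (forall x, shift S l (D x) = minus x (P x)) ->
  (forall x, D (shift S l x) = minus x (P x)) ->
  (forall x, P (D x) = zero) ->
  (exists x, power (shift S l) (d - 1) (P x) <> zero) ->
  pole S l.
Proof.
move=> lS sp d1 lP lD nilP Pid ND DN PD [x0 hx0].
split => //.
have lN := is_linear_shift S l lS.
case: (linear_norm D lD) => K0 [K0p hK0].
(* K >= 1 ensures that |w| K < 1 also gives |w| <= 1, as [laurent_term_bound] requires. *)
set K := K0 + 1.
have K1 : 1 <= K by rewrite /K; lra.
have hK x : norm (D x) <= K * norm x by have := hK0 x; have := norm_ge_0 x; rewrite /K; nra.
have Kp : 0 < / K by apply: Rinv_0_lt_compat; lra.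
exists d, (mkposreal _ Kp), (laurent_coeff (shift S l) P D d).
split => //; split; first by move=> j; exact: laurent_coeff_linear.
split.
  exists x0. rewrite /laurent_coeff (proj2 (Nat.ltb_lt _ _)); last lia. by rewrite Nat.sub_0_r.
move=> z [z0 zK]. simpl in zK. set w := (z - l)%C in z0 zK *.
have w0 : w <> RtoC 0 by move=> h; rewrite h Cmod_0 in z0; lra.
have wK : Cmod w * K < 1.
  have := Rmult_lt_compat_r K _ _ ltac:(lra) zK. rewrite Rinv_l; lra.
have w1 : Cmod w <= 1 by have := Cmod_ge_0 w; nra.
have inv : invertible (shift S z).
  case: (shift_invertible_near _ P D d lN lP lD d1 nilP ND DN PD Pid K K1 hK w w0 wK) => B [lB hB].
  exists B; split => // x. rewrite !(shift_shift S l z). exact: hB.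
split; first by move=> h; apply: h.
case: (inv) => B [lB hB]. case: (linear_norm B lB) => M [M0 hM] eps.
have cK : 0 <= Cmod w * K < 1 by split => //; apply: Rmult_le_pos; [exact: Cmod_ge_0 | lra].
case: (pow_to_zero (Cmod w * K) (M * (Cmod w * K)) eps cK (cond_pos eps)) => m hm.
exists (d + m)%nat => n hn x.
pose k := (n - d)%nat. have en : n = (d + k)%nat by rewrite /k; lia.
set s := sum_n _ n.
have es : s = laurent_sum (laurent_coeff (shift S l) P D d) w n x by [].
set e := minus s _.
(* S - z reduces the truncation error to one telescoped term. Its bounded inverse B carries the
   estimate back with a constant independent of x, which is convergence in operator norm. *)
have he : shift S z e = opp (scal w (scal (w ^ n)%C (laurent_coeff (shift S l) P D d n x))).
  rewrite /e (linear_minus (shift S z)); last exact: is_linear_shift.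
  rewrite (linear_scal (shift S z)); last exact: is_linear_shift.
  have -> : shift S z (resolvent S z x) = opp x.
    rewrite -{2}(resolvent_spec S z x inv) /shift. vec; ring.
  have := laurent_telescope (shift S l) P D d lN d1 nilP ND PD w n x.
  rewrite -es (proj2 (Nat.leb_le _ _)); last lia.
  rewrite (shift_shift S l z) -/w => h.
  have -> : minus (shift S l s) (scal w s) = opp (minus (scal w s) (shift S l s)) by vec; ring.
  rewrite h Cpow_S. vec; ring.
have -> : e = B (shift S z e) by rewrite (proj1 (hB e)).
apply: Rle_trans (hM _) _. rewrite he norm_opp norm_scal_eq en.
have h := laurent_term_bound (shift S l) P D d d1 K K1 hK w k x w1.
have nx := norm_ge_0 x. have c0 := Cmod_ge_0 w.
have hk := hm k ltac:(rewrite /k; lia).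
apply: (Rle_trans _ (M * (Cmod w * (K * norm x * (Cmod w * K) ^ k)))).
  apply: Rmult_le_compat_l; first lra. exact: Rmult_le_compat_l.
have -> : M * (Cmod w * (K * norm x * (Cmod w * K) ^ k)) = M * (Cmod w * K) * (Cmod w * K) ^ k *
  norm x by ring.
apply: Rmult_le_compat_r => //. lra.
Qed.

End Laurent.

(** * Poles are B-Weyl points *)

Section PoleBWeyl.
Context {H : HilbertSpace}.
Implicit Types (x y z u v : H) (A B N P D T S : H -> H) (l w : C) (M L : H -> Prop).

(** * Limits in H and uniqueness of power series coefficients *)

Lemma conv_minus (u v : nat -> H) x y : conv u x -> conv v y ->
  conv (fun n => minus (u n) (v n)) (minus x y).
Proof.
move=> hu hv eps e0.
case: (hu (eps / 2)); first lra. move=> n1 h1. case: (hv (eps / 2)); first lra. move=> n2 h2.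
exists (n1 + n2)%nat => n hn.
have -> : minus (minus (u n) (v n)) (minus x y) = minus (minus (u n) x) (minus (v n) y) by vec;
  ring.
apply: Rle_lt_trans (norm_triangle _ _) _. rewrite norm_opp.
have := h1 n ltac:(lia). have := h2 n ltac:(lia). lra.
Qed.

Lemma conv_scal a (u : nat -> H) x : conv u x -> conv (fun n => scal a (u n)) (scal a x).
Proof. move=> h. apply: (conv_linear (fun x => scal a x)) => //. apply: is_linear_scale. exact:
  is_linear_id. Qed.

Lemma conv_S (u : nat -> H) x : conv u x -> conv (fun n => u (S n)) x.
Proof. move=> h eps e0. case: (h eps e0) => n0 hn. exists n0 => n h'. apply: hn. lia. Qed.

Lemma conv_of_S (u : nat -> H) x : conv (fun n => u (S n)) x -> conv u x.
Proof. move=> h eps e0. case: (h eps e0) => n0 hn. exists (S n0) => [[|n]] h'; first lia. apply: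
  hn. lia. Qed.

Lemma conv_const x : conv (fun _ => x) x.
Proof. move=> eps e0. exists O => n _. by rewrite minus_eq_zero norm_zero. Qed.

Lemma conv_eventually (u v : nat -> H) x m : (forall n, (m <= n)%nat -> u n = v n) -> conv u x ->
  conv v x.
Proof. move=> e h eps e0. case: (h eps e0) => n0 hn. exists (n0 + m)%nat => n h'. rewrite -e;
  last lia. apply: hn. lia. Qed.

Lemma conv_bounded (u : nat -> H) x : conv u x -> exists B : R, forall n, norm (u n) <= B.
Proof.
move=> h. case: (h 1); first lra. move=> n0 hn.
have [B hB] : exists B : R, forall n, (n <= n0)%nat -> norm (u n) <= B.
  elim: (n0) => [|m [B hB]].
    exists (norm (u O)) => n h'. rewrite (_ : n = O); [exact: Rle_refl | lia].
  exists (Rmax B (norm (u (S m)))) => n h'.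
  case: (Nat.eq_dec n (S m)) => [->|ne]; first exact: Rmax_r.
  apply: Rle_trans (Rmax_l _ _). apply: hB. lia.
exists (Rmax B (1 + norm x)) => n.
case: (le_lt_dec n n0) => h'; first by apply: Rle_trans (Rmax_l _ _); exact: hB.
apply: Rle_trans (Rmax_r _ _).
have -> : u n = plus (minus (u n) x) x by vec; ring.
apply: Rle_trans (norm_triangle _ _) _. have := hn n ltac:(lia). lra.
Qed.

(** Convergence at w = r/2 bounds the terms there by some B. At w = t r/2 the terms after the head
    then sum to at most 2 B t, while the whole series is zero; so |q_0| <= 2 B t for all small t. *)
Lemma power_series_zero_head (q : nat -> H) r : 0 < r ->
  (forall w, 0 < Cmod w < r -> conv (fun n => sum_n (fun j => scal (w ^ j)%C (q j)) n) zero) ->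
  q O = zero.
Proof.
move=> r0 h.
have h0 : conv (fun n => sum_n (fun j => scal (RtoC (r / 2) ^ j)%C (q j)) n) zero.
  apply: h. rewrite Cmod_R Rabs_pos_eq; lra.
have [B hB] : exists B : R, forall n, norm (scal (RtoC (r / 2) ^ n)%C (q n)) <= B.
  apply: (conv_bounded _ (minus zero zero)). apply: conv_of_S.
  apply: (conv_eventually _ _ _ O _ (conv_minus _ _ _ _ (conv_S _ _ h0) h0)).
  move=> n _. rewrite sum_Sn. vec; ring.
have B0 : 0 <= B by apply: Rle_trans (hB O); exact: norm_ge_0.
apply: norm_eq_zero. apply: Rle_antisym; last exact: norm_ge_0.
apply: le_epsilon => eps e0. rewrite Rplus_0_l.
(* The first bound makes 1 / (1 - t) at most 2, the second makes 2 B t at most eps; the 1 covers B =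
   0. *)
pose t := Rmin (/ 2) (eps / (2 * B + 1)).
have t0 : 0 < t by apply: Rmin_glb_lt; [lra | apply: Rdiv_lt_0_compat; lra].
have t1 : t <= / 2 by exact: Rmin_l.
have t2 : t <= eps / (2 * B + 1) by exact: Rmin_r.
have t3 : 2 * B * t <= eps.
  have := Rmult_le_compat_l (2 * B + 1) _ _ ltac:(lra) t2.
  have -> : (2 * B + 1) * (eps / (2 * B + 1)) = eps by field; lra. lra.
pose w := RtoC (t * (r / 2)).
pose u n := sum_n (fun j => scal (w ^ j)%C (q j)) n.
have cu : conv u zero.
  apply: h. rewrite Cmod_R Rabs_pos_eq; nra.
have st n : norm (minus (u (S n)) (u n)) <= B * t * t ^ n.
  rewrite /u sum_Sn.
  have -> : minus (plus (sum_n (fun j => scal (w ^ j)%C (q j)) n) (scal (w ^ S n)%C (q (S n))))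
    (sum_n (fun j => scal (w ^ j)%C (q j)) n) = scal (RtoC (t ^ S n)) (scal (RtoC (r / 2) ^ S
      n)%C (q (S n))).
    rewrite /w RtoC_mult Cpow_mult_l RtoC_pow. vec; ring.
  have tn : 0 <= t ^ S n by apply: pow_le; lra.
  rewrite norm_scal_eq Cmod_R Rabs_pos_eq //.
  have := Rmult_le_compat_l _ _ _ tn (hB (S n)). rewrite /=. lra.
have bt : 0 <= B * t by apply: Rmult_le_pos; lra.
have hd := geometric_dist u (B * t) t ltac:(lra) bt st O.
have e : B * t * t ^ 0 / (1 - t) <= 2 * B * t.
  rewrite /= Rmult_1_r. apply: (Rmult_le_reg_r (1 - t)); first lra.
  have -> : B * t / (1 - t) * (1 - t) = B * t by field; lra.
  have := Rmult_le_compat_l (B * t) _ _ bt t1. lra.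
have := conv_dist_le u zero (q O) (2 * B * t) cu.
rewrite norm_minus_sym. have -> : minus (q O) zero = q O by vec; ring.
move=> hh. apply: Rle_trans t3. apply: hh. exists O => n _.
have := hd n. rewrite Nat.add_0_l {2}/u sum_O.
have -> : scal (w ^ 0)%C (q O) = q O by vec; rewrite /=; ring.
lra.
Qed.

Lemma power_series_zero (q : nat -> H) r : 0 < r ->
  (forall w, 0 < Cmod w < r -> conv (fun n => sum_n (fun j => scal (w ^ j)%C (q j)) n) zero) ->
  forall j, q j = zero.
Proof.
move=> r0 h j. elim: j q h => [|j IH] q h; first exact: (power_series_zero_head q r).
apply: (IH (fun j => q (S j))) => w hw.
have q0 := power_series_zero_head q r r0 h.
have w0 : w <> RtoC 0 by move=> e; rewrite e Cmod_0 in hw; lra.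
have := conv_scal (/ w)%C _ _ (conv_S _ _ (h w hw)). rewrite scal_zero_r.
apply: (conv_eventually _ _ _ O) => n _.
elim: n => [|n IHn].
  rewrite sum_Sn !sum_O q0. vec. rewrite Cpow_1_r /=. field. done.
rewrite sum_Sn [RHS]sum_Sn -IHn. vec. rewrite (Cpow_S w (S n)). field. done.
Qed.

Lemma resolvent_commutes T A (c : C) x : is_linear A -> (forall x, T (A x) = A (T x)) ->
  invertible (shift T c) -> resolvent T c (A x) = A (resolvent T c x).
Proof.
move=> lA com inv. apply: resolvent_unique => //.
rewrite com -(linear_scal A) // -(linear_minus A) //. congr A. exact: resolvent_spec.
Qed.

Lemma pole_coefficients S l : is_linear S -> pole S l ->
  exists k (Q : nat -> H -> H), (1 <= k)%nat /\ (forall j, is_linear (Q j)) /\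
   (forall x, shift S l (Q O x) = zero) /\
   (forall j x, shift S l (Q (Datatypes.S j) x) = minus (Q j x) (if (Datatypes.S j =? k)%nat then
     x else zero)) /\
   (forall j x, shift S l (Q j x) = Q j (shift S l x)).
Proof.
move=> lS [_ [k [r [Q [k1 [lQ [_ hz]]]]]]].
exists k, Q; do 2 (split => //).
have lN := is_linear_shift S l lS. set N := shift S l in lN *.
have defN x : N x = minus (S x) (scal l x) by [].
clearbody N.
have cv w x : 0 < Cmod w < r -> invertible (shift S (w + l)%C) /\
   conv (fun n => sum_n (fun j => scal (w ^ j)%C (Q j x)) n) (scal (w ^ k)%C (resolvent S (w +
     l)%C x)).
  move=> hw. case: (hz (w + l)%C).
    by have -> : (w + l - l)%C = w by ring.
  have -> : (w + l - l)%C = w by ring.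
  move=> ns os. split; first by apply: NNPP.
  move=> eps e0. have nx := norm_ge_0 x.
  have e1 : 0 < eps / (norm x + 1) by apply: Rdiv_lt_0_compat; lra.
  case: (os (mkposreal _ e1)) => n0 hn. exists n0 => n h.
  apply: Rle_lt_trans (hn n h x) _. rewrite /=.
  apply: (Rlt_le_trans _ (eps / (norm x + 1) * (norm x + 1))).
    apply: Rmult_lt_compat_l => //; lra.
  right; field; lra.
have rs w x : invertible (shift S (w + l)%C) ->
   minus (scal w (resolvent S (w + l)%C x)) (N (resolvent S (w + l)%C x)) = x.
  move=> inv. rewrite -{3}(resolvent_spec S _ x inv) defN. vec; ring.
(* Coefficient of w^j in (w - N) sum_i w^i Q_i x - w^k x, which vanishes near 0 by the resolvent
   equation. As k >= 1, the term w^k x does not reach index 0. *)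
pose co x (j : nat) : H := if j is Datatypes.S i
  then minus (minus (Q i x) (N (Q j x))) (if (j =? k)%nat then x else zero) else opp (N (Q O x)).
have co0 x : co x O = opp (N (Q O x)) by [].
have coS x i : co x (Datatypes.S i) =
  minus (minus (Q i x) (N (Q (Datatypes.S i) x))) (if (Datatypes.S i =? k)%nat then x else zero)
    by [].
move: co co0 coS => co co0 coS.
have main x : forall j, co x j = zero.
  apply: (power_series_zero _ r (cond_pos r)) => w hw.
  case: (cv w x hw) => inv c.
  apply: conv_of_S.
  have -> : (zero : H) = minus (minus (scal w (scal (w ^ k)%C (resolvent S (w + l)%C x))) (N
    (scal (w ^ k)%C (resolvent S (w + l)%C x)))) (scal (w ^ k)%C x).
    rewrite -{3}(rs w x inv) (linear_scal N) //. vec; ring.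
  apply: (conv_eventually _ _ _ k _ (conv_minus _ _ _ _ (conv_minus _ _ _ _ (conv_scal w _ _ c)
    (conv_linear N _ _ lN (conv_S _ _ c))) (conv_const (scal (w ^ k)%C x)))).
  move=> n hn.
  (* Multiplication by w raises indices by one, so the partial sum multiplied by w stops one index
     earlier than the one under N. *)
  have gen m : sum_n (fun j => scal (w ^ j)%C (co x j)) (Datatypes.S m) =
    minus (minus (scal w (sum_n (fun j => scal (w ^ j)%C (Q j x)) m)) (N (sum_n (fun j => scal (w
      ^ j)%C (Q j x)) (Datatypes.S m)))) (if (k <=? Datatypes.S m)%nat then scal (w ^ k)%C x else
      zero).
    elim: m => [|m IH].
      rewrite 2!sum_Sn !sum_O (linear_plus N) // !(linear_scal N) // co0 coS.
      case: (Nat.eqb_spec 1 k) => e.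
        rewrite (proj2 (Nat.leb_le _ _)); last lia. rewrite -e. vec. rewrite /=. ring.
      rewrite (proj2 (Nat.leb_gt _ _)); last lia. vec. rewrite /=. ring.
    rewrite sum_Sn IH coS !sum_Sn.
    move: (sum_n (fun j => scal (w ^ j)%C (Q j x)) m) => s.
    rewrite !(linear_plus N) // !(linear_scal N) //.
    rewrite (Cpow_S w (Datatypes.S m)) (Cpow_S w m).
    case: (Nat.eqb_spec (Datatypes.S (Datatypes.S m)) k) => e.
      rewrite (proj2 (Nat.leb_gt _ _)); last lia. rewrite (proj2 (Nat.leb_le _ _)); last lia.
      rewrite -e (Cpow_S w (Datatypes.S m)) (Cpow_S w m). vec; ring.
    case: (Nat.leb_spec k (Datatypes.S m)) => h.
      rewrite (proj2 (Nat.leb_le _ _)); last lia. vec; ring.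
    rewrite (proj2 (Nat.leb_gt _ _)); last lia. vec; ring.
  rewrite gen (proj2 (Nat.leb_le _ _)) //. lia.
split.
  move=> x. by rewrite -(opp_opp (N _)) -co0 (main x O) opp_zero.
split.
  move=> j x. symmetry. apply: minus_zero. apply: eq_trans (main x (Datatypes.S j)). rewrite coS.
    vec; ring.
(* N commutes with the resolvent, so N Q_j x and Q_j N x are coefficients of the same function of
   w. *)
move=> j x. apply: minus_zero. move: j.
apply: (power_series_zero _ r (cond_pos r)) => w hw.
case: (cv w x hw) => inv c. case: (cv w (N x) hw) => _ c'.
have -> : (zero : H) = minus (N (scal (w ^ k)%C (resolvent S (w + l)%C x))) (scal (w ^ k)%C
  (resolvent S (w + l)%C (N x))).
  rewrite (linear_scal N) // (resolvent_commutes S N) //; first by rewrite minus_eq_zero.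
  move=> y. rewrite !defN (linear_minus S) // (linear_scal S) //.
apply: (conv_eventually _ _ _ O _ (conv_minus _ _ _ _ (conv_linear N _ _ lN c) c')).
move=> n _. elim: n => [|n IH].
  rewrite !sum_O (linear_scal N) //. vec; ring.
rewrite !sum_Sn -IH (linear_plus N) // (linear_scal N) //. vec; ring.
Qed.

Lemma closed_null A : is_linear A -> closed (null A).
Proof.
move=> lA x h. apply: NNPP => hx. apply: h.
have nx : 0 < norm (A x).
  case: (Rle_lt_or_eq_dec 0 _ (norm_ge_0 (A x))) => // e. case: hx. by apply: norm_eq_zero.
case: (linear_norm A lA) => K [K0 hK].
have f0 := @norm_factor_gt_0 _ (hs_space H).
have e0 : 0 < norm (A x) / K / @norm_factor _ (hs_space H).
  apply: Rdiv_lt_0_compat => //. exact: Rdiv_lt_0_compat.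
exists (mkposreal _ e0) => y hy. have := norm_compat2 _ _ _ hy. rewrite /=.
have -> : @norm_factor _ (hs_space H) * (norm (A x) / K / @norm_factor _ (hs_space H)) = norm (A
  x) / K by field; lra.
move=> h1 h2. have := hK (minus y x). rewrite (linear_minus A) // h2.
have -> : minus zero (A x) = opp (A x) by vec; ring.
rewrite norm_opp => h3.
apply: (Rlt_irrefl (norm (A x))). apply: Rle_lt_trans h3 _.
apply: Rlt_le_trans (Rmult_lt_compat_l K _ _ K0 h1) _. right; field; lra.
Qed.

Lemma lincomb_0 a (e : nat -> H) : lincomb a e 0 = zero.
Proof. exact: sum_n_m_zero. Qed.

Lemma quotient_dim_0 M L : quotient_dim M L 0 <-> (forall x, M x -> L x).
Proof.
split.
- move=> [e [_ [_ h]]] x hx. case: (h x hx) => a. rewrite lincomb_0.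
  by have -> : minus x zero = x by vec; ring.
- move=> h. exists (fun _ => zero). do 2 (split; first by move=> *; lia).
  move=> x hx. exists (fun _ => RtoC 0). rewrite lincomb_0.
  have -> : minus x zero = x by vec; ring. exact: h.
Qed.

Lemma pole_BWeyl S l : is_linear S -> pole S l -> BWeyl (shift S l).
Proof.
move=> lS hp. case: (pole_coefficients S l lS hp) => k [Q [k1 [lQ [f0 [fS com]]]]].
have := is_linear_shift S l lS. move: f0 fS com. move: (shift S l) => N f0 fS com lN.
have lA n : is_linear (power N n) by exact: is_linear_power.
have comn n j x : Q j (power N n x) = power N n (Q j x) by apply: power_comm => y; rewrite com.
have low j x : (j < k)%nat -> power N (Datatypes.S j) (Q j x) = zero.
  elim: j => [|j IH] hj; first exact: f0.
  rewrite power_S_r fS (proj2 (Nat.eqb_neq _ _)); last lia.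
  have -> : minus (Q j x) zero = Q j x by vec; ring. apply: IH. lia.
(* In the regular part N lowers the index, so Q_j factors through every power of N; in the principal
   part, [low], it ends at 0. *)
have high m j x : (k <= j)%nat -> power N m (Q (j + m)%nat x) = Q j x.
  elim: m j => [|m IH] j hj; first by rewrite Nat.add_0_r.
  rewrite power_S_r -plus_n_Sm fS (proj2 (Nat.eqb_neq _ _)); last lia.
  have -> : minus (Q (j + m)%nat x) zero = Q (j + m)%nat x by vec; ring. exact: IH.
(* The residue of the resolvent, that is, the spectral projection. The recurrence at index k - 1
   reads 1 = E - N Q_k, so - Q_k inverts N on ker E. *)
set E := Q (k - 1)%nat.
have hE x : power N k (E x) = zero.
  have := low (k - 1)%nat x ltac:(lia). by rewrite (_ : Datatypes.S (k - 1) = k); last lia.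
have split_id x : x = minus (E x) (N (Q k x)).
  have := fS (k - 1)%nat x. rewrite (_ : Datatypes.S (k - 1) = k); last lia.
  rewrite Nat.eqb_refl => ->. rewrite -/E. vec; ring.
have asc m x : power N m x = zero -> power N k x = zero.
  move=> h. rewrite (split_id x) -(high m k x) // -comn h (linear_zero (Q _)) // (linear_zero N) //.
  have -> : minus (E x) zero = E x by vec; ring. exact: hE.
(* Identifying R(N^k) with the kernel of a bounded operator is what makes it closed. *)
have rangeE x : range (power N k) x <-> E x = zero.
  split.
    move=> [y <-]. by rewrite /E comn hE.
  move=> h. exists (opp (Q (k + (k - 1))%nat x)).
  rewrite linear_opp // {1}(_ : k = Datatypes.S (k - 1)); last lia.
  rewrite /power /= -/(power N (k - 1) _) high //.
  rewrite [RHS]split_id h. vec; ring.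
have nul x : range (power N k) x -> N x = zero -> x = zero.
  move=> hx h0. move/rangeE: (hx) => e. rewrite (split_id x) e com h0 (linear_zero (Q k)) //.
  exact: minus_eq_zero.
have sur m : (forall x, power N k x = zero -> power N m x = zero) ->
    forall y, range (power N m) y -> range_on (range (power N m)) N y.
  move=> hm y [x <-]. exists (power N m (opp (Q k x))); split; first by exists (opp (Q k x)).
  rewrite power_comm // {2}(split_id x) (linear_minus (power N m)) // (hm (E x)) // (linear_opp
    N) // (linear_opp (power N m)) //. vec; ring.
split.
- exists k; split; last split; last split.
  + apply: (closed_ext (null E)); last by apply: closed_null; exact: lQ.
    move=> x. symmetry. exact: rangeE.
  + exists O. apply/quotient_dim_0 => x [h1 h2]. exact: nul.
  + apply: (closed_ext (null E)); last by apply: closed_null; exact: lQ.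
    move=> y. rewrite /null -rangeE. split; first exact: sur.
    move=> [x [[u <-] <-]]. exists (N u). by rewrite power_comm.
  + exists O. apply/quotient_dim_0. exact: sur.
- have stk : stable_from N k.
    move=> m x _ [h1 h2]. rewrite (nul x h1 h2). split; last exact: linear_zero.
    exists zero. exact: linear_zero.
  have [d [sd mind]] : exists d, is_dis N d.
    case: (dec_inh_nat_subset_has_unique_least_element (stable_from N)).
    - move=> n. exact: classic.
    - by exists k.
    move=> d [[h1 h2] _]. by exists d.
  (* The index is taken at d, the facts above at k. Stability places ker N meet R(N^d) inside
     R(N^k), where N is injective; this transfers injectivity to d and then gives ker N^k inside ker
     N^d, as [sur] requires. *)
  have dk : (d <= k)%nat by apply: mind.
  have nuld x : range (power N d) x -> N x = zero -> x = zero.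
    move=> h1 h2. apply: nul => //. exact: (proj1 (sd k x dk (conj h1 h2))).
  exists d; split; first by split.
  exists O, O; split; last split; last by [].
  + apply/quotient_dim_0 => x [h1 h2]. exact: nuld.
  + apply/quotient_dim_0. apply: sur => x hx.
    have gen j : power N (j + d) x = zero -> power N d x = zero.
      elim: j => [|j IH] // h. apply: IH. apply: nuld => //.
      exists (power N j x). by rewrite -power_add Nat.add_comm.
    apply: (gen (k - d)%nat). by rewrite Nat.sub_add.
Qed.

End PoleBWeyl.

(** * Eigenvectors of complex matrices *)

Module MatrixEigenvector.
Import all_boot all_algebra complex Rstruct.
Import GRing.Theory.
Local Open Scope ring_scope.

(** Translates between the two encodings of complex numbers as pairs of reals, so that
    characteristic polynomials and algebraic closedness of R[i] can serve matrices over [C]. *)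
Definition of_complex (z : (R : Num.RealClosedField.type)[i]) : C :=
  (complex.Re z, complex.Im z).
Definition to_complex (z : C) : R[i] := Complex (fst z) (snd z).

Lemma of_complexK z : to_complex (of_complex z) = z.
Proof. by case: z. Qed.

Lemma to_complexK z : of_complex (to_complex z) = z.
Proof. by case: z. Qed.

Lemma of_complexD z w : of_complex (z + w) = Cplus (of_complex z) (of_complex w).
Proof. by case: z => a b; case: w => c d. Qed.

Lemma of_complexM z w : of_complex (z * w) = Cmult (of_complex z) (of_complex w).
Proof. by case: z => a b; case: w => c d. Qed.

Lemma of_complex_sum n (G : nat -> R[i]) :
  of_complex (\sum_(i < n) G i) = sum_n_m (fun i => of_complex (G i.-1)) 1 n.
Proof.
elim: n => [|n IH]; first by rewrite big_ord0 sum_n_m_zero.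
rewrite big_ord_recr /= of_complexD IH.
rewrite sum_n_Sm //. by apply/leP.
Qed.

(** The characteristic polynomial has degree n >= 1, hence a root. A row eigenvector is wanted
    because row i of A will hold the coordinates of T e_i. Matrix indices start at 0, those of sums
    at 1. *)
Lemma matrix_eigenvector n (A : nat -> nat -> C) : (1 <= n)%coq_nat ->
  exists (v : nat -> C) (mu : C),
    (exists i, ((1 <= i)%coq_nat /\ (i <= n)%coq_nat) /\ v i <> RtoC 0) /\
    forall j, ((1 <= j)%coq_nat /\ (j <= n)%coq_nat) ->
      sum_n_m (fun i => Cmult (v i) (A i j)) 1 n = Cmult mu (v j).
Proof.
case: n => [|n _]; first by move/leP.
pose M : 'M[R[i]]_n.+1 := \matrix_(i, j) to_complex (A i.+1 j.+1).
have /closed_rootP [a ra] : size (char_poly M) != 1%N by rewrite size_char_poly.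
have /eigenvalueP [v vM vn0] : eigenvalue M a by rewrite eigenvalue_root_char.
exists (fun i => of_complex (v 0 (inord i.-1))), (of_complex a); split.
  have [i vi] : exists i, v 0 i != 0.
    apply/existsP; apply: contraNT vn0 => /existsPn h.
    by apply/eqP/rowP => i; rewrite mxE; apply/eqP/negPn.
  exists i.+1; split; first by split; apply/leP.
  move=> h; case/eqP: vi; rewrite -[LHS]of_complexK.
  by move: h; rewrite /= inord_val => ->.
move=> [|j] [hj1 hj2]; first by move/leP: hj1.
have := congr1 (fun u : 'rV__ => of_complex (u 0 (inord j))) vM.
rewrite !mxE of_complexM /= => <-.
have jn : (j < n.+1)%N by apply/leP.
rewrite (eq_bigr (fun i : 'I_n.+1 => v 0 (inord i) * to_complex (A i.+1 j.+1))); last first.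
  by move=> i _; rewrite mxE inordK // inord_val.
rewrite (of_complex_sum _ (fun i => v 0 (inord i) * to_complex (A i.+1 j.+1))).
apply: sum_n_m_ext_loc => k [k1 _].
rewrite of_complexM to_complexK; congr (Cmult _ (A _ _)).
by move: k1; case: k => // /leP.
Qed.
End MatrixEigenvector.

(** * The generalized Browder theorem *)

Section Browder.
Context {H : HilbertSpace}.
Implicit Types (x y u v : H) (T S : H -> H) (M : H -> Prop).

(** * Linear combinations and eigenvectors in finite dimension *)

Lemma lincomb_S a (e : nat -> H) n :
  lincomb a e (Datatypes.S n) = plus (lincomb a e n) (scal (a (Datatypes.S n)) (e (Datatypes.S n))).
Proof. rewrite /lincomb sum_n_Sm //. lia. Qed.

Lemma lincomb_ext a a' (e e' : nat -> H) n :
  (forall i, (1 <= i <= n)%nat -> a i = a' i /\ e i = e' i) -> lincomb a e n = lincomb a' e' n.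
Proof. move=> h. apply: sum_n_m_ext_loc => i hi. by case: (h i hi) => -> ->. Qed.

Lemma lincomb_plus a b (e : nat -> H) n :
  lincomb (fun i => a i + b i)%C e n = plus (lincomb a e n) (lincomb b e n).
Proof.
elim: n => [|n IH]; first by rewrite !lincomb_0 plus_zero_l.
rewrite !lincomb_S IH. vec; ring.
Qed.

Lemma lincomb_scal c a (e : nat -> H) n : lincomb (fun i => c * a i)%C e n = scal c (lincomb a e n).
Proof.
elim: n => [|n IH]; first by rewrite !lincomb_0 scal_zero_r.
rewrite !lincomb_S IH. vec; ring.
Qed.

Lemma lincomb_linear T a (e : nat -> H) n : is_linear T ->
  T (lincomb a e n) = lincomb a (fun i => T (e i)) n.
Proof.
move=> lT. elim: n => [|n IH]; first by rewrite !lincomb_0; exact: linear_zero.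
by rewrite !lincomb_S (linear_plus T) // (linear_scal T) // IH.
Qed.

Lemma lincomb_lincomb (v : nat -> C) (A : nat -> nat -> C) (e : nat -> H) m n :
  lincomb v (fun i => lincomb (A i) e n) m =
  lincomb (fun j => sum_n_m (fun i => v i * A i j)%C 1 m) e n.
Proof.
elim: m => [|m IH].
  rewrite lincomb_0 -(scal_zero_l (lincomb (fun _ => RtoC 0) e n)) -lincomb_scal.
  apply: lincomb_ext => i _; split => //. rewrite sum_n_m_zero; last lia.
  rewrite /zero /=. ring.
rewrite lincomb_S IH -lincomb_scal -lincomb_plus. apply: lincomb_ext => j _; split => //.
rewrite sum_n_Sm //. lia.
Qed.

Lemma finite_dim_eigenvector T M n : is_linear T -> (1 <= n)%nat ->
  M zero -> (forall x y, M x -> M y -> M (plus x y)) -> (forall a x, M x -> M (scal a x)) ->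
  (forall x, M x -> M (T x)) -> dim M n ->
  exists x (mu : C), x <> zero /\ M x /\ T x = scal mu x.
Proof.
move=> lT n1 M0 Mp Ms MT [e [he [free span]]].
(* Stated for every i, with a default outside 1..n, so that choice produces a total function [A]. *)
have coef i : exists a : nat -> C, (1 <= i <= n)%nat -> T (e i) = lincomb a e n.
  case: (classic (1 <= i <= n)%nat) => hi; last by exists (fun _ => RtoC 0).
  case: (span (T (e i))); first by apply: MT; exact: he.
  move=> a ha. exists a => _. exact: minus_zero.
pose A i := proj1_sig (constructive_indefinite_description _ (coef i)).
have hA i : (1 <= i <= n)%nat -> T (e i) = lincomb (A i) e n.
  exact: (proj2_sig (constructive_indefinite_description _ (coef i))).
case: (MatrixEigenvector.matrix_eigenvector n A n1) => v [mu [[i [hi vi]] hv]].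
exists (lincomb v e n), mu; split; last split.
- move=> h. apply: vi. exact: (free v h).
- have gen m : (m <= n)%nat -> M (lincomb v e m).
    elim: m => [|m IH] hm; first by rewrite lincomb_0.
    rewrite lincomb_S. apply: Mp; first by apply: IH; lia.
    apply: Ms. apply: he. lia.
  exact: gen.
- rewrite lincomb_linear // -lincomb_scal -(lincomb_ext _ _ e _ _ (fun j hj => conj (hv j hj)
  (eq_refl (e j)))).
  rewrite -lincomb_lincomb. apply: lincomb_ext => j hj; split => //. exact: hA.
Qed.

Lemma BWeyl_pole S T l : is_linear S -> is_linear T -> (forall x, S (T x) = T (S x)) ->
  (forall x (mu : C), x <> zero -> T x = scal mu x -> S x = scal l x -> ~ range (shift S l) x) ->
  spectrum S l -> BWeyl (shift S l) -> pole S l.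
Proof.
move=> lS lT com core sp [_ [d [[sd mind] [a [b [ha [hb hk]]]]]]].
have lN := is_linear_shift S l lS.
have lA n : is_linear (power (shift S l) n) by exact: is_linear_power.
have comN x : shift S l (T x) = T (shift S l x).
  rewrite /shift com (linear_minus T) // (linear_scal T) //.
have eab : a = b by lia.
have a0 : a = O.
  case: (Nat.eq_dec a 0) => // na.
  case: (finite_dim_eigenvector T (null_on (range (power (shift S l) d)) (shift S l)) a) => //.
  - lia.
  - split; last exact: linear_zero. exists zero. exact: linear_zero.
  - move=> x y [[u <-] hx] [[v <-] hy]; split.
      exists (plus u v). exact: linear_plus.
    by rewrite (linear_plus (shift S l)) // hx hy plus_zero_l.
  - move=> c x [[u <-] hx]; split.
      exists (scal c u). exact: linear_scal.
    by rewrite (linear_scal (shift S l)) // hx scal_zero_r.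
  - move=> x [[u <-] hx]; split.
      exists (T u). rewrite -power_comm //.
    by rewrite comN hx linear_zero.
  move=> x [mu [x0 [[hr hx] hT]]]. exfalso. apply: (core x mu) => //.
    exact: minus_zero.
  (* Stability puts x in R(N^(d+1)), hence in R(N), which [core] forbids. *)
  case: (sd (Datatypes.S d) x ltac:(lia) (conj hr hx)) => [[u hu] _].
  by exists (power (shift S l) d u).
rewrite -eab a0 in hb. rewrite a0 in ha.
move/quotient_dim_0: ha => ha. move/quotient_dim_0: hb => hb.
have inj x : range (power (shift S l) d) x -> shift S l x = zero -> x = zero.
  move=> h1 h2. by apply: ha.
have surj y : range (power (shift S l) d) y -> range (power (shift S l) (Datatypes.S d)) y.
  move=> h. case: (hb y h) => x [[u <-] <-]. by exists u.
have d1 : (1 <= d)%nat.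
  (* With d = 0 the operator N would be bijective on H, and l would lie outside the spectrum. *)
  case: (Nat.eq_dec d 0) => nd; last lia. exfalso. apply: sp. rewrite nd in inj surj.
  apply: bijective_invertible => //.
  - move=> x. apply: inj. by exists x.
  - move=> y. case: (surj y); first by exists y. move=> x hx. by exists x.
case: (drazin (shift S l) d lN inj surj) => P [D [lP [lD [nilP [Pid [_ [ND [DN PD]]]]]]]].
apply: (drazin_pole S l d P D) => //.
(* The leading coefficient N^(d-1) P is nonzero by minimality of d: otherwise ker N would meet
   R(N^(d-1)) only in 0, and stability would already hold at d - 1. *)
apply: NNPP => hn.
have : (d <= d - 1)%nat; last by lia.
apply: mind => m x _ [[u hu] hx].
suff -> : x = zero by split; [exists zero; exact: linear_zero | exact: linear_zero].
have e : power (shift S l) d u = zero.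
  rewrite (_ : d = Datatypes.S (d - 1)); last lia. by rewrite /power /= -/(power (shift S l) (d -
    1) u) hu.
rewrite -hu -(Pid u e). apply: NNPP => h. apply: hn. by exists u.
Qed.

(** Common reduction for S = f(T) and S = T: it remains to keep the joint eigenvectors of T and S
    out of the range of S - l. *)
Lemma generalized_Browder_of_commutant S T : is_linear S -> is_linear T ->
  (forall x, S (T x) = T (S x)) ->
  (forall x (mu l : C), x <> zero -> T x = scal mu x -> S x = scal l x -> ~ range (shift S l) x) ->
  generalized_Browder S.
Proof.
move=> lS lT com core l; split.
- move=> [sp bw]. apply: (BWeyl_pole S T) => //; last by apply: NNPP.
  move=> x mu. exact: core.
- move=> hp. split; first exact: (proj1 hp). move=> h; apply: h. exact: pole_BWeyl.
Qed.

(** If x = (S - l) t, the component of t in M contributes nothing and the orthogonal one stays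
    orthogonal to M; so x is orthogonal to M, hence to itself. *)
Lemma not_range_of_reducing S M l x : is_linear S -> closed_subspace M ->
  (forall u, M u -> S u = scal l u) ->
  (forall q, (forall m, M m -> inner q m = RtoC 0) -> forall m, M m -> inner (S q) m = RtoC 0) ->
  M x -> x <> zero -> ~ range (shift S l) x.
Proof.
move=> lS hM sM sQ hx x0 [t ht]. apply: x0. apply: inner_self_zero.
case: (orthogonal_projection M t hM) => p [hp hq].
have e : x = minus (S (minus t p)) (scal l (minus t p)).
  rewrite -ht /shift (linear_minus S) // (sM p) //. vec; ring.
rewrite {1}e inner_minus_l inner_scal sQ // hq //. ring.
Qed.

Lemma reducing_orthogonal T M q : is_linear T -> reduces M T ->
  (forall m, M m -> inner q m = RtoC 0) -> forall m, M m -> inner (T q) m = RtoC 0.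
Proof. move=> lT [_ red] hq m hm. rewrite adjoint_spec //. apply: hq. exact: red. Qed.

Lemma eigenspace_closed_subspace T l : is_linear T -> closed_subspace (null (shift T l)).
Proof. move=> lT. apply: null_closed_subspace. exact: is_linear_shift. Qed.

Lemma contour_int_ext (G : contour) (h h' : C -> C) :
  (forall z : C, on_contour G z -> h z = h' z) -> contour_int G h = contour_int G h'.
Proof.
move=> e. rewrite /contour_int. congr fold_right. apply: map_ext_in => g hg.
apply (RInt_ext (V := C_R_CompleteNormedModule)) => t. rewrite Rmin_left ?Rmax_right; try lra.
  move=> ht. rewrite e //.
exists g; split => //. exists t; split => //. lra.
Qed.

Lemma contour_int_0 (G : contour) : contour_int G (fun _ => RtoC 0) = RtoC 0.
Proof.
rewrite /contour_int. elim: G => //= g G ->.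
rewrite (RInt_ext _ (fun _ => (RtoC 0 : C_R_CompleteNormedModule))).
  rewrite RInt_const. rewrite scal_zero_r. exact: Cplus_0_l.
move=> t _. exact: Cmult_0_l.
Qed.

(** * Action of f(T) on the eigenspaces of T and on their complements *)

Section Calculus.
Variables (T S : H -> H) (U : C -> Prop) (f : C -> C).
Hypotheses (lT : is_linear T) (hS : is_functional_calculus T U f S).

(** Moving T to the other side of the inner product turns both entries into contour integrals, and
    their integrands agree since the resolvent commutes with T. *)
Lemma calculus_commutes x : S (T x) = T (S x).
Proof.
case: hS => lS [G [[_ [hG _]] int]].
apply: inner_ext => y. rewrite (adjoint_spec T) // !int. congr Cmult.
apply: contour_int_ext => z hz. have inv : invertible (shift T z).
  by apply: NNPP; exact: (proj2 (hG z hz)).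
rewrite (resolvent_commutes T T) // adjoint_spec //.
Qed.

Lemma resolvent_eigenvector (z mu : C) u : invertible (shift T z) -> z <> mu ->
  T u = scal mu u -> resolvent T z u = scal (/ (z - mu))%C u.
Proof.
move=> inv ne hu. apply: resolvent_unique => //. rewrite (linear_scal T) // hu. vec. field.
move=> h. apply: ne. by rewrite -(Cplus_0_l mu) -h; ring.
Qed.

Lemma eigenvalue_spectrum (mu : C) x : x <> zero -> T x = scal mu x -> spectrum T mu.
Proof.
move=> x0 hx [B [lB inv]]. apply: x0. rewrite -(proj1 (inv x)) /shift hx minus_eq_zero.
exact: linear_zero.
Qed.

(* On an eigenspace of T the matrix entry <Su, y> depends on <u, y> only, and
   <x, y> takes all complex values; hence S is the scalar l on the whole eigenspace,
   and Cauchy's theorem is not needed. *)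
Lemma calculus_scalar (mu l : C) x : x <> zero -> T x = scal mu x -> S x = scal l x ->
  forall u, T u = scal mu u -> S u = scal l u.
Proof.
move=> x0 hx hl. case: hS => lS [G [[_ [hG _]] int]].
have sp := eigenvalue_spectrum mu x x0 hx.
pose phi b := (/ (2 * PI * Ci) * contour_int G (fun z => f z * (/ (z - mu) * b)))%C.
have ent u y : T u = scal mu u -> inner (S u) y = phi (inner u y).
  move=> hu. rewrite int /phi. congr Cmult. apply: contour_int_ext => z hz.
  case: (hG z hz) => _ nz.
  rewrite (resolvent_eigenvector z mu) //; first by rewrite inner_scal.
    exact: NNPP.
  by move=> e; apply: nz; rewrite e.
have xx : inner x x <> RtoC 0 by move=> /inner_self_zero.
have hphi b : phi b = (l * b)%C.
  have eb : inner x (scal (Cconj (b / inner x x)) x) = b.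
    rewrite inner_scal_r Cconj_conj. by field.
  by rewrite -{1}eb -ent // hl inner_scal eb.
move=> u hu. apply: inner_ext => y. by rewrite ent // hphi inner_scal.
Qed.

(** The integrand vanishes. If p is the projection onto the eigenspace of r = (z - T)^-1 q, then q =
    (z - mu) p + (z - T) (r - p) with the last term orthogonal to the eigenspace. Pairing with p
    gives (z - mu) |p|^2 = 0, and z differs from mu because the contour misses the spectrum. *)
Lemma calculus_orthogonal (mu : C) : spectrum T mu -> reduces (null (shift T mu)) T ->
  forall q, (forall m, null (shift T mu) m -> inner q m = RtoC 0) ->
  forall m, null (shift T mu) m -> inner (S q) m = RtoC 0.
Proof.
move=> sp red q hq m hm. case: hS => lS [G [[_ [hG _]] int]].
rewrite int (contour_int_ext _ _ (fun _ => RtoC 0)); first by rewrite contour_int_0; ring.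
move=> z hz. case: (hG z hz) => _ nz. have inv : invertible (shift T z) by apply: NNPP.
have hM := eigenspace_closed_subspace T mu lT.
case: (orthogonal_projection _ (resolvent T z q) hM) => p [hp ho].
set r := resolvent T z q in ho *.
have hTp : T p = scal mu p by apply: minus_zero.
have e : q = plus (scal (z - mu)%C p) (minus (scal z (minus r p)) (T (minus r p))).
  rewrite -[LHS](resolvent_spec T z q inv) -/r (linear_minus T) // hTp. vec; ring.
have p0 : p = zero.
  have := hq p hp.
  rewrite e inner_plus inner_minus_l !inner_scal ho // (reducing_orthogonal T _ _ lT red ho) //.
  move=> h. apply: inner_self_zero.
  have ne : (z - mu)%C <> RtoC 0.
    move=> h'. apply: nz. have -> : z = mu by rewrite -(Cplus_0_l mu) -h'; ring. done.
  have -> : inner p p = (/ (z - mu) * ((z - mu) * inner p p + (z * RtoC 0 - RtoC 0)))%C by field.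
  rewrite h. ring.
have -> : r = minus r p by rewrite p0; vec; ring.
rewrite ho //. ring.
Qed.

End Calculus.

End Browder.

Theorem corollary3p5 (H : HilbertSpace) (T : H -> H)
    (Hinf : infinite_dimensional H)
    (HT : is_linear T)
    (Hred : reduced_by_eigenspaces T) :
  (forall (U : C -> Prop) (f : C -> C) (fT : H -> H),
     analytic_near (spectrum T) U f ->
     is_functional_calculus T U f fT ->
     generalized_Browder fT) /\
  generalized_Browder T.
Proof.
split.
- move=> U f S _ hS. apply: (generalized_Browder_of_commutant S T) => //.
  + exact: (proj1 hS).
  + exact: (calculus_commutes T S U f).
  + move=> x mu l x0 hx hl.
    have ev : eigenvalue T mu by exists x.
    apply: (not_range_of_reducing S (null (shift T mu))) => //.
    * exact: (proj1 hS).
    * exact: eigenspace_closed_subspace.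
    * move=> u hu. apply: (calculus_scalar T S U f HT hS mu l x) => //. exact: minus_zero.
    * apply: (calculus_orthogonal T S U f) => //; last exact: Hred.
      exact: (eigenvalue_spectrum T mu x).
    * by rewrite /null /shift hx minus_eq_zero.
- apply: (generalized_Browder_of_commutant T T) => // x mu l x0 _ hl.
  apply: (not_range_of_reducing T (null (shift T l))) => //.
  + exact: eigenspace_closed_subspace.
  + move=> u hu. exact: minus_zero.
  + move=> q. apply: reducing_orthogonal => //. apply: Hred. by exists x.
  + by rewrite /null /shift hl minus_eq_zero.
Qed.
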